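(* Let $W(3,2,2)$ be a three-web of codimension two on a four-dimensional manifold $M^4$ with nowhere vanishing covector $a=\{a_1,a_2\}$, and let $p_{ij},q_{ij}$ be the Pfaffian derivatives of $a$. The transversal $a$-distribution $\Delta$ defined by the equations $$a_1\omega_{(1)}^1+a_2\omega_{(1)}^2=0,\qquad a_1\omega_{(2)}^1+a_2\omega_{(2)}^2=0$$ is integrable if and only if $$a_2^2p_{11}-2a_1a_2p_{(12)}+a_1^2p_{22}=0,\qquad a_2^2q_{11}-2a_1a_2q_{(12)}+a_1^2q_{22}=0 .$$
   Context: A web $W(3,2,2)$ on a 4-manifold $M^4$ consists of three foliations $\lambda_1,\lambda_2,\lambda_3$ of codimension 2 in general position (their tangent planes are pairwise transversal at each point). All considerations are local. Indices $i,j,k,l$ range over $\{1,2\}$; repeated indices are summed; round (square) brackets around indices denote symmetrization (alternation) with averaging, e.g. $p_{(12)}=\frac12(p_{12}+p_{21})$. The foliation $\lambda_u$ is given by $\omega_{(u)}^i=0$, $i=1,2$, where the 1-forms are normalized so that $\omega_{(1)}^i+\omega_{(2)}^i+\omega_{(3)}^i=0$; the forms $\omega_{(1)}^i,\omega_{(2)}^i$ form a coframe on $M^4$. Admissible coframe changes are $\omega_{(\alpha)}^{i'}=A^{i'}_j\omega_{(\alpha)}^j$ with the same nondegenerate matrix for $\alpha=1,2$. The structure equations are $$d\omega_{(1)}^i=\omega_{(1)}^j\wedge\omega_j^i+a_j\omega_{(1)}^j\wedge\omega_{(1)}^i,\qquad d\omega_{(2)}^i=\omega_{(2)}^j\wedge\omega_j^i-a_j\omega_{(2)}^j\wedge\omega_{(2)}^i,$$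 which determine the connection forms $\omega_j^i$ and the covector $a=\{a_1,a_2\}$ (the torsion tensor being $a^i_{jk}=a_{[j}\delta^i_{k]}$), together with $$d\omega_j^i-\omega_j^k\wedge\omega_k^i=b^i_{jkl}\,\omega_{(1)}^k\wedge\omega_{(2)}^l,\qquad da_i-a_j\omega_i^j=p_{ij}\omega_{(1)}^j+q_{ij}\omega_{(2)}^j,$$ where $b^i_{jkl}$ is the curvature tensor and $p_{ij},q_{ij}$ are called the Pfaffian derivatives of $a$; they satisfy $b^i_{[j|l|k]}=\delta^i_{[k}p_{j]l}$ and $b^i_{[jk]l}=\delta^i_{[k}q_{j]l}$. *)

(* Defs.v *)
From HB Require Import structures.
From mathcomp Require Import all_boot all_order all_algebra.
From mathcomp Require Import classical_sets reals topology normedtype derive.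
Set Implicit Arguments.
Unset Strict Implicit.
Unset Printing Implicit Defensive.
Import Order.TTheory GRing.Theory Num.Theory.
Import numFieldNormedType.Exports.
Local Open Scope classical_set_scope.
Local Open Scope ring_scope.

(* All considerations being local, the manifold M^4 is an open set U of
   R^4 = 'rV[R]_4, i.e. the domain of a chart; a tangent vector at a point is an
   element of 'rV[R]_4.  Functions and forms are total, but only their values
   on U matter. *)

Section Smooth.
Variables (R : realType) (V W : normedModType R).

Definition iter_derive (s : seq V) (f : V -> W) : V -> W :=
  foldr (fun v g => 'D_v g) f s.

(* C^oo on the open set U: all iterated directional derivatives (the empty one
   being f itself) are differentiable at every point of U. *)
Definition smooth_on (U : set V) (f : V -> W) : Prop :=
  forall (s : seq V) (x : V), U x -> differentiable (iter_derive s f) x.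

End Smooth.

Section Forms.
Variable R : realType.

(* A 1-form on R^4 is given by its coefficients in the basis dx^1, ..., dx^4. *)
Definition form1 : Type := 'rV[R]_4 -> 'cV[R]_4.

(* A 2-form, as a function of a point and of two tangent vectors. *)
Definition form2 : Type := 'rV[R]_4 -> 'rV[R]_4 -> 'rV[R]_4 -> R.

Definition ev (al : form1) (x v : 'rV[R]_4) : R := (v *m al x) 0 0.

(* (al /\ be)(u, v) = al(u) be(v) - al(v) be(u); accordingly the exterior
   derivative below carries no factor 1/2. *)
Definition wedge (al be : form1) : form2 :=
  fun x u v => ev al x u * ev be x v - ev al x v * ev be x u.

(* d al (u, v) = u(al(v)) - v(al(u)) for constant vector fields u, v, whose
   bracket vanishes. *)
Definition dform (al : form1) : form2 :=
  fun x u v => 'D_u (fun y => ev al y v) x - 'D_v (fun y => ev al y u) x.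

End Forms.

Section Distributions.
Variable R : realType.

(* A field of tangent subspaces: x |-> the set of vectors tangent at x. *)
Definition tangent_distribution : Type := 'rV[R]_4 -> set 'rV[R]_4.

(* T is the field of tangent planes of a foliation of codimension 2 of U: the
   leaves are locally the level sets of a submersion onto an open set of R^2. *)
Definition foliation (U : set 'rV[R]_4) (T : tangent_distribution) : Prop :=
  forall p, U p -> exists (V : set 'rV[R]_4) (f : 'rV[R]_4 -> 'rV[R]_2),
    [/\ open V, V p, V `<=` U, smooth_on V f &
        forall x, V x ->
          (forall w : 'rV[R]_2, exists v : 'rV[R]_4, 'd f x v = w) /\
          (forall v : 'rV[R]_4, T x v <-> 'd f x v = 0)].

Definition transversal (P Q : set 'rV[R]_4) : Prop :=
  forall v : 'rV[R]_4, exists v1 v2, [/\ P v1, Q v2 & v = v1 + v2].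

(* The distribution of planes D is integrable on U: through every point of U
   there passes an integral surface, i.e. an immersed surface whose tangent
   plane at each of its points is the plane of D. *)
Definition integrable_distribution (U : set 'rV[R]_4) (D : tangent_distribution) : Prop :=
  forall p, U p -> exists (N : set 'rV[R]_2) (phi : 'rV[R]_2 -> 'rV[R]_4),
    [/\ open N, N 0, smooth_on N phi, phi 0 = p &
        forall s, N s ->
          [/\ U (phi s),
              (forall h : 'rV[R]_2, 'd phi s h = 0 -> h = 0) &
              (forall v : 'rV[R]_4,
                 D (phi s) v <-> exists h : 'rV[R]_2, 'd phi s h = v)]].

End Distributions.

Section ThreeWeb.
Variable R : realType.

(* A web W(3,2,2) on U, given by the tangent planes T u of its foliations. *)
Definition three_web (U : set 'rV[R]_4) (T : 'I_3 -> tangent_distribution R) : Prop :=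
  (forall u, foliation U (T u)) /\
  (forall x, U x -> forall u w, u != w -> transversal (T u x) (T w x)).

(* om u i is omega_(u)^i; the foliations (1), (2), (3) and the indices 1, 2 are
   numbered from 0. *)
Record adapted_coframe (U : set 'rV[R]_4) (T : 'I_3 -> tangent_distribution R)
    (om : 'I_3 -> 'I_2 -> form1 R) : Prop := AdaptedCoframe {
  om_smooth : forall u i, smooth_on U (om u i);
  om_foliation : forall u x v, U x -> (T u x v <-> forall i, ev (om u i) x v = 0);
  om_normalized : forall i x, U x -> om 0 i x + om 1 i x + om 2 i x = 0;
  om_coframe : forall x v, U x ->
    (forall i, ev (om 0 i) x v = 0) -> (forall i, ev (om 1 i) x v = 0) -> v = 0 }.

(* conn j i is the connection form omega_j^i, b i j k l is b^i_{jkl}. *)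
Record structure_equations (U : set 'rV[R]_4) (om : 'I_3 -> 'I_2 -> form1 R)
    (conn : 'I_2 -> 'I_2 -> form1 R) (a : 'I_2 -> 'rV[R]_4 -> R)
    (b : 'I_2 -> 'I_2 -> 'I_2 -> 'I_2 -> 'rV[R]_4 -> R) : Prop :=
    StructureEquations {
  conn_smooth : forall j i, smooth_on U (conn j i);
  a_smooth : forall i, smooth_on U (a i);
  structure_om1 : forall i x u v, U x ->
    dform (om 0 i) x u v =
      \sum_(j < 2) wedge (om 0 j) (conn j i) x u v
      + \sum_(j < 2) a j x * wedge (om 0 j) (om 0 i) x u v;
  structure_om2 : forall i x u v, U x ->
    dform (om 1 i) x u v =
      \sum_(j < 2) wedge (om 1 j) (conn j i) x u v
      - \sum_(j < 2) a j x * wedge (om 1 j) (om 1 i) x u v;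
  structure_conn : forall i j x u v, U x ->
    dform (conn j i) x u v - \sum_(k < 2) wedge (conn j k) (conn k i) x u v =
      \sum_(k < 2) \sum_(l < 2) b i j k l x * wedge (om 0 k) (om 1 l) x u v }.

(* d a_i - a_j omega_i^j = p_ij omega_(1)^j + q_ij omega_(2)^j *)
Definition pfaffian_derivatives (U : set 'rV[R]_4)
    (om : 'I_3 -> 'I_2 -> form1 R) (conn : 'I_2 -> 'I_2 -> form1 R)
    (a : 'I_2 -> 'rV[R]_4 -> R) (p q : 'I_2 -> 'I_2 -> 'rV[R]_4 -> R) : Prop :=
  forall i x v, U x ->
    'D_v (a i) x - \sum_(j < 2) a j x * ev (conn i j) x v =
      \sum_(j < 2) p i j x * ev (om 0 j) x v
      + \sum_(j < 2) q i j x * ev (om 1 j) x v.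

Definition a_distribution (om : 'I_3 -> 'I_2 -> form1 R)
    (a : 'I_2 -> 'rV[R]_4 -> R) : tangent_distribution R :=
  fun x => [set v | a 0 x * ev (om 0 0) x v + a 1 x * ev (om 0 1) x v = 0 /\
                    a 0 x * ev (om 1 0) x v + a 1 x * ev (om 1 1) x v = 0].

Definition symm (t : 'I_2 -> 'I_2 -> 'rV[R]_4 -> R) (i j : 'I_2)
    (x : 'rV[R]_4) : R := (t i j x + t j i x) / 2.

End ThreeWeb.

(* Main.v *)
Require Import Defs.
From HB Require Import structures.
From mathcomp Require Import all_boot all_order all_algebra.
From mathcomp Require Import ring lra.
From mathcomp Require Import all_classical.
From mathcomp Require Import classical_sets reals interval_inference topology normedtype landau derive.
Set Implicit Arguments.
Unset Strict Implicit.
Unset Printing Implicit Defensive.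
Import Order.TTheory GRing.Theory Num.Theory.
Import numFieldNormedType.Exports.
Local Open Scope classical_set_scope.
Local Open Scope ring_scope.

(* Put [theta^alpha = a_i omega_(alpha)^i], so that Delta is the kernel of the matrix
   [theta x].  By the structure equations the connection and torsion terms of
   [d theta^alpha] cancel; evaluated on two vectors of Delta, [d theta^1] and
   [d theta^2] are the two quadratic expressions in [q] and in [p] of the theorem
   times a determinant.  It remains to see that Delta is integrable iff the
   [d theta^alpha] vanish on it (Frobenius).
   Necessity: pull back to an integral surface and use Schwarz's theorem.
   Sufficiency: Delta is the row space of a matrix [A x] whose rows commute as
   vector fields, and an integral surface is a solution of the total equation
   [d phi_h k = k A(phi h)], [phi 0 = p].  Let [E_n h] be the endpoint of the
   Euler polygon with [n] steps for [z' = h A(z)] on [0, 1].  Because the rows of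
   [A] commute,
     [| E_n h + k A(E_n h) - E_n (h + k) | <= C / n + C |k|^2],
   so any limit of [E_n] along an ultrafilter solves the total equation. *)

(** * Differentiability: remainder bounds, locality, matrix entries *)

Lemma near_translate (R : numFieldType) (V : normedModType R) (x : V) (P : set V) :
  (\forall y \near x, P y) -> \forall h \near 0, P (h + x).
Proof.
move=> /nbhs_ballP[e /= e0 He]; apply/nbhs_ballP; exists e => //= h.
rewrite -!ball_normE /= => bh; apply: He; rewrite -ball_normE /=.
by rewrite opprD addrCA subrr addr0 -[- h]sub0r.
Qed.

Section Differentiability.
Variables (R : realType) (V W : normedModType R).

(** An explicit bound on the remainder identifies the differential and proves its existence at once;
    the limit of Euler polygons is differentiated this way. *)
Lemma is_diff_of_remainder (f : V -> W) (df : {linear V -> W}) (x : V) :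
  continuous df ->
  (forall e, 0 < e -> \forall h \near 0, `|f (h + x) - f x - df h| <= e * `|h|) ->
  is_diff x f df.
Proof.
move=> cdf H.
have E : f \o shift x = cst (f x) + df +o_ 0 id.
  apply/eqaddoP => _/posnumP[e]; near=> h.
  rewrite /= -[(_ - _ : _ -> _) _]/(_ - _) -[(_ + _ : _ -> _) _]/(_ + _) /=.
  by rewrite opprD addrA; near: h; exact: H.
have D := diff_unique cdf E.
apply: DiffDef => //; apply/diff_locallyP; split; first by rewrite D.
by rewrite D.
Unshelve. all: by end_near. Qed.

(** The differential of [f] at [x] also serves for [g], because the two remainders agree for small
    increments. *)
Lemma near_eq_differentiable (f g : V -> W) (x : V) :
  (\near x, f x = g x) -> differentiable f x -> differentiable g x.
Proof.
move=> fg df.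
suff : is_diff x g ('d f x) by case.
apply: is_diff_of_remainder; first exact: diff_continuous.
move=> e e0.
have [_ /eqaddoP/(_ e e0) H] := (diff_locallyP x f).1 df.
have fg' : \forall h \near 0, f (h + x) = g (h + x).
  exact: (@near_translate _ _ _ (fun y => f y = g y)).
near=> h; rewrite -(nbhs_singleton fg) -(near fg' h) //.
have : `|(f \o shift x - (cst (f x) + 'd f x)) h| <= e * `|id h| by near: h.
by rewrite -[(_ - _ : _ -> _) _]/(_ - _) -[(_ + _ : _ -> _) _]/(_ + _) /= opprD addrA.
Unshelve. all: by end_near. Qed.

End Differentiability.

Lemma differentiable_bigsum (R : realType) (V W : normedModType R) I (r : seq I)
    (f : I -> V -> W) (x : V) :
  (forall i, differentiable (f i) x) ->
  differentiable (fun y => \sum_(i <- r) f i y) x.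
Proof.
move=> df; elim: r => [|i r IH]; first by under eq_fun do rewrite big_nil.
under eq_fun do rewrite big_cons.
exact: (@differentiableD _ _ _ (f i) (fun y => \sum_(j <- r) f j y)).
Qed.

Lemma differentiable_mx (R : realType) (V : normedModType R) m n
    (M : V -> 'M[R]_(m, n)) (x : V) :
  differentiable M x <-> forall i j, differentiable (fun y => M y i j) x.
Proof.
split=> [dM i j|dM].
  apply: (@differentiable_comp _ _ _ _ M (fun N : 'M[R]_(m, n) => N i j)) => //.
  exact: differentiable_coord.
have -> : M = fun y => \sum_i \sum_j M y i j *: delta_mx i j.
  by apply/funext => y; rewrite {1}(matrix_sum_delta (M y)).
apply: differentiable_bigsum => i; apply: differentiable_bigsum => j.
exact: differentiableZl.
Qed.

(** * Calculus of functions of class C^k *)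

Section Smoothness.
Variables (R : realType) (V : normedModType R).
Implicit Types (U : set V).

(** At level [k], all iterated directional derivatives of order at most [k] are differentiable;
    level 0 is thus differentiability, not mere continuity. *)
Fixpoint Ck (W : normedModType R) (k : nat) U (f : V -> W) : Prop :=
  (forall x, U x -> differentiable f x) /\
  if k is k'.+1 then forall v, Ck k' U ('D_v f) else True.

Lemma Ck_differentiable (W : normedModType R) k U (f : V -> W) x :
  Ck k U f -> U x -> differentiable f x.
Proof. by case: k => [|k] [+ _] => /[apply]. Qed.

Lemma CkW (W : normedModType R) k U (f : V -> W) : Ck k.+1 U f -> Ck k U f.
Proof.
elim: k f => [|k IH] f [df Df]; split => // v; exact: IH.
Qed.

Lemma Ck_derive (W : normedModType R) k U (f : V -> W) v :
  Ck k.+1 U f -> Ck k U ('D_v f).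
Proof. by case=> _; apply. Qed.

Lemma Ck_sub (W : normedModType R) k U U' (f : V -> W) :
  U' `<=` U -> Ck k U f -> Ck k U' f.
Proof.
move=> UU'; elim: k f => [|k IH] f [df Df]; split => //.
- by move=> x /UU'; exact: df.
- by move=> x /UU'; exact: df.
- by move=> v; exact: IH (Df v).
Qed.

(** The list is peeled from its end: [iter_derive] applies its head last, whereas [Ck] starts by
    differentiating [f] itself. *)
Lemma smooth_onP (W : normedModType R) U (f : V -> W) :
  smooth_on U f <-> forall k, Ck k U f.
Proof.
have rcons_iter s v g : iter_derive (rcons s v) g = iter_derive s ('D_v g) :> (V -> W).
  by rewrite /iter_derive foldr_rcons.
split=> [sf k|Cf s x Ux].
  elim: k f sf => [|k IH] f sf.
    by split => // x Ux; exact: (sf [::]).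
  split=> [x Ux|v]; first exact: (sf [::]).
  by apply: IH => s x Ux; rewrite -rcons_iter; exact: sf.
elim/last_ind: s f Cf => [|s v IH] f Cf; first exact: Ck_differentiable (Cf 0) Ux.
by rewrite rcons_iter; apply: IH => k; exact: Ck_derive.
Qed.

(** Since [U] is open, equality on [U] holds near each of its points and so passes to derivatives. A
    derivative formula valid on [U] thereby yields regularity. *)
Lemma Ck_ext (W : normedModType R) k U (f g : V -> W) : open U ->
  (forall x, U x -> f x = g x) -> Ck k U f -> Ck k U g.
Proof.
move=> oU.
have loc f' g' x : (forall x : V, U x -> f' x = g' x :> W) -> U x ->
    \near x, f' x = g' x.
  by move=> fg Ux; apply: filterS (open_nbhs_nbhs (conj oU Ux)) => y; exact: fg.
elim: k f g => [|k IH] f g fg [df Df]; split => //.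
- move=> x Ux; apply: near_eq_differentiable (df _ Ux); exact: loc.
- move=> x Ux; apply: near_eq_differentiable (df _ Ux); exact: loc.
move=> v; apply: IH (Df v) => x Ux; apply: near_eq_derive; exact: loc.
Qed.

Lemma Ck_cst (W : normedModType R) k U (c : W) : Ck k U (cst c).
Proof.
elim: k c => [|k IH] c; split => // v.
suff -> : 'D_v (cst c) = cst 0 :> (V -> W) by [].
by apply/funext => x; rewrite derive_cst.
Qed.

Lemma CkD (W : normedModType R) k U (f g : V -> W) : open U ->
  Ck k U f -> Ck k U g -> Ck k U (f \+ g).
Proof.
move=> oU; elim: k f g => [|k IH] f g Cf Cg.
  by split => // x Ux; apply: differentiableD;
    [exact: Ck_differentiable Cf Ux|exact: Ck_differentiable Cg Ux].
split=> [x Ux|v].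
  by apply: differentiableD;
    [exact: Ck_differentiable Cf Ux|exact: Ck_differentiable Cg Ux].
apply: (Ck_ext oU) (IH _ _ (Ck_derive v Cf) (Ck_derive v Cg)) => x Ux /=.
by rewrite deriveD //; apply: diff_derivable;
  [exact: Ck_differentiable Cf Ux|exact: Ck_differentiable Cg Ux].
Qed.

Lemma Ck_sum (W : normedModType R) I (r : seq I) (P : pred I) k U (f : I -> V -> W) :
  open U -> (forall i, P i -> Ck k U (f i)) ->
  Ck k U (fun x => \sum_(i <- r | P i) f i x).
Proof.
move=> oU Cf; elim: r => [|i r IH].
  by under eq_fun do rewrite big_nil; exact: Ck_cst.
case Pi: (P i); under eq_fun do rewrite big_cons Pi; last exact: IH.
by apply: CkD => //; exact: Cf.
Qed.

Lemma CkM k U (f g : V -> R) : open U ->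
  Ck k U f -> Ck k U g -> Ck k U (f \* g).
Proof.
move=> oU; elim: k f g => [|k IH] f g Cf Cg.
  by split => // x Ux; apply: differentiableM;
    [exact: Ck_differentiable Cf Ux|exact: Ck_differentiable Cg Ux].
split=> [x Ux|v].
  by apply: differentiableM;
    [exact: Ck_differentiable Cf Ux|exact: Ck_differentiable Cg Ux].
apply: (Ck_ext oU) (CkD oU (IH _ _ (CkW Cf) (Ck_derive v Cg))
                           (IH _ _ (CkW Cg) (Ck_derive v Cf))) => x Ux /=.
by rewrite (_ : f \* g = f * g) // deriveM //; apply: diff_derivable;
  [exact: Ck_differentiable Cf Ux|exact: Ck_differentiable Cg Ux].
Qed.

Lemma Ck_prod I (r : seq I) (P : pred I) k U (f : I -> V -> R) :
  open U -> (forall i, P i -> Ck k U (f i)) ->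
  Ck k U (fun x => \prod_(i <- r | P i) f i x).
Proof.
move=> oU Cf; elim: r => [|i r IH].
  by under eq_fun do rewrite big_nil; exact: Ck_cst.
case Pi: (P i); under eq_fun do rewrite big_cons Pi; last exact: IH.
by apply: CkM => //; exact: Cf.
Qed.

Lemma CkV k U (f : V -> R) : open U -> (forall x, U x -> f x != 0) ->
  Ck k U f -> Ck k U (fun x => (f x)^-1).
Proof.
move=> oU f0; elim: k f f0 => [|k IH] f f0 Cf.
  by split => // x Ux; apply: differentiableV; [exact: Ck_differentiable Cf Ux|exact: f0].
split=> [x Ux|v].
  by apply: differentiableV; [exact: Ck_differentiable Cf Ux|exact: f0].
(* The derivative of [1/f] is minus the product of [1/f], [1/f] and ['D_v f]; the induction
   hypothesis covers the two factors [1/f]. *)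
have CV := IH _ f0 (CkW Cf).
have CN : Ck k U (cst (-1) : V -> R) by exact: Ck_cst.
apply: (Ck_ext oU) (CkM oU CN (CkM oU (CkM oU CV CV) (Ck_derive v Cf))) => x Ux /=.
rewrite deriveV ?f0 //; last by apply: diff_derivable; exact: Ck_differentiable Cf Ux.
by rewrite /GRing.scale /= -exprVn expr2 !mulNr mul1r.
Qed.

Lemma Ck_mx k m n U (M : V -> 'M[R]_(m, n)) : open U ->
  Ck k U M <-> forall i j, Ck k U (fun x => M x i j).
Proof.
move=> oU; elim: k M => [|k IH] M.
  split=> [CM i j|CM]; split => // x Ux.
    by have /differentiable_mx := Ck_differentiable CM Ux; exact.
  by apply/differentiable_mx => i j; exact: Ck_differentiable (CM i j) Ux.
have DM v x i j : differentiable M x -> 'D_v M x i j = 'D_v (fun y => M y i j) x.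
  by move=> dM; rewrite derive_mx ?mxE //; exact: diff_derivable.
split=> [[dM CM] i j|CM].
  split=> [x Ux|v]; first by have /differentiable_mx := dM _ Ux; exact.
  apply: Ck_ext oU _ ((IH _).1 (CM v) i j) => x Ux; exact/DM/dM.
have dM x : U x -> differentiable M x.
  by move=> Ux; apply/differentiable_mx => i j; exact: Ck_differentiable (CM i j) Ux.
split=> // v; apply/(IH _) => i j.
by apply: Ck_ext oU _ (Ck_derive v (CM i j)) => x Ux; rewrite DM //; exact: dM.
Qed.

End Smoothness.

(** * The mean value theorem along a segment *)

Section MeanValue.
Variables (R : realType) (V : normedModType R).
Implicit Types (f : V -> R) (x w : V).

Lemma derive_scaler (W : normedModType R) (f : V -> W) (x w : V) (t : R) :
  differentiable f x -> 'D_(t *: w) f x = t *: 'D_w f x.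
Proof. by move=> df; rewrite !deriveE // linearZ. Qed.

Lemma is_derive_line (f : V -> R) (x w : V) (t : R) :
  differentiable f (x + t *: w) ->
  is_derive t 1 (fun s : R => f (x + s *: w)) ('D_w f (x + t *: w)).
Proof.
move=> df.
have dl : is_diff t (fun s : R => x + s *: w) (fun s => s *: w).
  have -> : (fun s : R => s *: w) = 0 + ( *:%R ^~ w) by apply/funext => s; rewrite -[LHS]add0r.
  exact: is_diffD.
have dc : is_diff t (f \o (fun s : R => x + s *: w)) ('d f (x + t *: w) \o (fun s => s *: w)).
  by apply: is_diff_comp; exact: differentiableP.
have dg : differentiable (f \o (fun s : R => x + s *: w)) t by case: dc.
apply: DeriveDef; first exact: diff_derivable.
rewrite (deriveE _ dg) diff_val /= scale1r deriveE //.
Qed.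

Lemma MVT_line f x w :
  (forall t, 0 <= t <= 1 -> differentiable f (x + t *: w)) ->
  exists2 c, 0 <= c <= 1 & f (x + w) - f x = 'D_w f (x + c *: w).
Proof.
move=> df.
have [||c] := @MVT R (fun s => f (x + s *: w)) (fun s => 'D_w f (x + s *: w)) 0 1 ltr01.
- move=> t; rewrite in_itv /= => /andP[t0 t1].
  by apply: is_derive_line; apply: df; rewrite !ltW.
- apply: derivable_within_continuous => t; rewrite in_itv /= => t01.
  by have [] := is_derive_line (df t t01).
rewrite in_itv /= => /andP[c0 c1]; rewrite scale1r scale0r addr0 subr0 mulr1 => H.
by exists c => //; rewrite !ltW.
Qed.

Lemma ball_segment (p x w : V) (r t : R) : 0 <= t <= 1 ->
  ball p r x -> ball p r (x + w) -> ball p r (x + t *: w).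
Proof.
move=> /andP[t0 t1]; rewrite -ball_normE /= => bx bxw.
have -> : p - (x + t *: w) = (1 - t) *: (p - x) + t *: (p - (x + w)).
  rewrite !opprD !addrA; move: (p - x) => y.
  by rewrite scalerBl scale1r scalerBr addrA subrK.
apply: (@le_lt_trans _ _ ((1 - t) * `|p - x| + t * `|p - (x + w)|)).
  rewrite (le_trans (ler_normD _ _)) // !normrZ !ger0_norm ?subr_ge0 //.
(* Both gaps to the radius are positive and at least one of them has a positive weight, so the
   inequality stays strict. *)
have : (1 - t) * (r - `|p - x|) + t * (r - `|p - (x + w)|) > 0.
  have [->|tn0] := eqVneq t 0; first by rewrite subr0 mul1r mul0r addr0 subr_gt0.
  by apply: ltr_wpDl; [apply: mulr_ge0; rewrite subr_ge0 // ltW|rewrite mulr_gt0 ?subr_gt0 // lt_neqAle eq_sym tn0].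
by move=> H; rewrite -subr_gt0; apply: lt_le_trans H _; rewrite le_eqVlt; apply/orP; left; apply/eqP; ring.
Qed.

End MeanValue.

(** * Functions of a row vector: chain rule and symmetry of second derivatives *)

Section Rows.
Variables (R : realType) (n : nat).
Notation V := 'rV[R]_n.

Lemma derive_coord (W : normedModType R) (f : V -> W) (x w : V) :
  differentiable f x ->
  'D_w f x = \sum_i w 0 i *: 'D_(delta_mx 0 i) f x.
Proof.
move=> df; rewrite deriveE // {1}(row_sum_delta w) linear_sum /=.
by apply: eq_bigr => i _; rewrite linearZ /= deriveE.
Qed.

Lemma derive_comp_row (U : normedModType R) (W : normedModType R) (f : V -> W) (phi : U -> V) (x v : U) :
  differentiable phi x -> differentiable f (phi x) ->
  'D_v (f \o phi) x =
    \sum_i 'D_v (fun y => phi y 0 i) x *: 'D_(delta_mx 0 i) f (phi x).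
Proof.
move=> dphi df; rewrite deriveE; last exact: differentiable_comp.
rewrite diff_comp //= -deriveE // -deriveE // derive_coord //.
by apply: eq_bigr => i _; rewrite derive_mx ?mxE //; exact: diff_derivable.
Qed.

(** By the chain rule a derivative of [f \o phi] is a sum of products of a derivative of a
    coordinate of [phi] with a partial derivative of [f] composed with [phi]; the induction
    hypothesis applies to the latter. *)
Lemma Ck_comp (U : normedModType R) k (N : set U) (O : set V) (phi : U -> V) (f : V -> R) :
  open N -> open O -> (forall x, N x -> O (phi x)) ->
  Ck k O f -> Ck k N phi -> Ck k N (f \o phi).
Proof.
move=> oN oO NO; elim: k f => [|k IH] f Cf Cphi.
  split=> // x Nx; apply: differentiable_comp; first exact: Ck_differentiable Cphi Nx.
  exact: Ck_differentiable Cf (NO _ Nx).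
have dphi x : N x -> differentiable phi x by exact: Ck_differentiable Cphi.
have df x : N x -> differentiable f (phi x).
  by move=> Nx; exact: Ck_differentiable Cf (NO _ Nx).
split=> [x Nx|v]; first by apply: differentiable_comp; [exact: dphi|exact: df].
have C : Ck k N (fun x => \sum_i 'D_v (fun y => phi y 0 i) x * 'D_(delta_mx 0 i) f (phi x)).
  apply: Ck_sum => // i _; apply: CkM => //.
    apply: Ck_derive; exact: (Ck_mx k.+1 phi oN).1.
  by apply: (IH ('D_(delta_mx 0 i) f)); [exact: Ck_derive|exact: CkW].
by apply: Ck_ext oN _ C => x Nx; rewrite derive_comp_row //; [exact: dphi|exact: df].
Qed.

Lemma Schwarz (O : set V) (f : V -> R) (p u v : V) : open O -> O p -> Ck 2 O f ->
  'D_u ('D_v f) p = 'D_v ('D_u f) p.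
Proof.
move=> oO Op C2.
have D2 a b x : O x -> differentiable ('D_a ('D_b f)) x.
  exact: Ck_differentiable (Ck_derive a (Ck_derive b C2)).
have D1 a x : O x -> differentiable ('D_a f) x.
  exact: Ck_differentiable (Ck_derive a C2).
have D0 x : O x -> differentiable f x by exact: Ck_differentiable C2.
have cuv a b : {for p, continuous ('D_a ('D_b f))}.
  by apply: differentiable_continuous; exact: D2.
have /nbhs_ballP[r /= r0 rO] := open_nbhs_nbhs (conj oO Op).
(* Both mixed derivatives compute the same second difference of [f]. *)
have quad (t : R) a b : 0 <= t -> t * (`|a| + `|b|) < r ->
    exists2 y, `|p - y| <= t * (`|a| + `|b|) &
      f (p + t *: a + t *: b) - f (p + t *: a) - (f (p + t *: b) - f p)
      = t * (t * 'D_b ('D_a f) y).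
  move=> t0 tr.
  have inO c d : 0 <= c <= 1 -> 0 <= d <= 1 ->
      `|p - (p + (c * t) *: a + (d * t) *: b)| <= t * (`|a| + `|b|).
    move=> /andP[c0 c1] /andP[d0 d1].
    rewrite -addrA opprD addrA subrr sub0r normrN (le_trans (ler_normD _ _)) //.
    rewrite !normrZ !ger0_norm ?mulr_ge0 // mulrDr lerD // ler_wpM2r //.
      by rewrite ler_piMl.
    by rewrite ler_piMl.
  have inO' c d : 0 <= c <= 1 -> 0 <= d <= 1 -> O (p + (c * t) *: a + (d * t) *: b).
    by move=> c01 d01; apply: rO; rewrite -ball_normE /=; exact: le_lt_trans (inO _ _ c01 d01) tr.
  have le01 : 0 <= (1 : R) <= 1 by rewrite ler01 lexx.
  have le00 : 0 <= (0 : R) <= 1 by rewrite ler01 lexx.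
  (* The mean value theorem is used twice: for the increment [G] along [t *: a], then for ['D_a f]
     along [t *: b]. *)
  pose G y := f (y + t *: b) - f y.
  have dsh y : O (y + t *: b) -> is_diff y (fun z => f (z + t *: b)) ('d f (y + t *: b)).
    move=> Oy.
    have dl : is_diff y (fun z : V => z + t *: b) id.
      have -> : (id : V -> V) = id + 0 by apply/funext => z; rewrite -[LHS]addr0.
      exact: is_diffD.
    have dc := @is_diff_comp _ _ _ _ _ _ f _ y dl (differentiableP (D0 _ Oy)).
    by [].
  have dG y : O y -> O (y + t *: b) -> 
      is_diff y G (('d f (y + t *: b) : V -> R) - ('d f y : V -> R)).
    by move=> Oy Oyb; apply: is_diffB; [exact: dsh|exact: differentiableP (D0 _ Oy)].
  have DG y w : O y -> O (y + t *: b) -> 'D_w G y = 'D_w f (y + t *: b) - 'D_w f y.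
    move=> Oy Oyb; have [dGy vG] := dG _ Oy Oyb.
    by rewrite deriveE // vG !deriveE //; exact: D0.
  have inOa c : 0 <= c <= 1 -> O (p + c *: (t *: a)).
    by move=> c01; have := inO' _ _ c01 le00; rewrite mul0r scale0r addr0 scalerA.
  have inOab c : 0 <= c <= 1 -> O (p + c *: (t *: a) + t *: b).
    by move=> c01; have := inO' _ _ c01 le01; rewrite mul1r scalerA.
  have [|c c01 Ec] := @MVT_line _ _ G p (t *: a).
    by move=> c c01; have [] := dG _ (inOa _ c01) (inOab _ c01).
  have inOb d : 0 <= d <= 1 -> O (p + c *: (t *: a) + d *: (t *: b)).
    by move=> d01; have := inO' _ _ c01 d01; rewrite !scalerA.
  have [|d d01 Ed] := @MVT_line _ _ ('D_a f) (p + c *: (t *: a)) (t *: b).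
    by move=> d d01; apply: D1; exact: inOb.
  exists (p + c *: (t *: a) + d *: (t *: b)); first by rewrite !scalerA; exact: inO.
  rewrite -[LHS]/(G (p + t *: a) - G p) Ec.
  rewrite DG; [|exact: inOa|exact: inOab].
  rewrite !derive_scaler; [|exact/D0/inOa|exact/D0/inOab].
  by rewrite -scalerBr Ed derive_scaler //; apply: D1; exact: inOb.
apply/eqP; rewrite -subr_eq0 -normr_le0; apply/ler_addgt0Pr => e e0.
have e20 : 0 < e / 2 by rewrite divr_gt0.
have /cvgrPdist_le/(_ _ e20)/nbhs_ballP[r1 /= r10 H1] := cuv u v.
have /cvgrPdist_le/(_ _ e20)/nbhs_ballP[r2 /= r20 H2] := cuv v u.
(* The summand 1 keeps [m] positive even if both directions vanish; with [t = s / (2 * m)] the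
   intermediate points stay within [s] of [p]. *)
pose m := `|u| + `|v| + 1.
have m0 : 0 < m by rewrite /m ltr_wpDl // addr_ge0.
pose s := Num.min r (Num.min r1 r2).
have s0 : 0 < s by rewrite !lt_min r0 r10.
pose t := s / (2 * m).
have t0 : 0 < t by rewrite divr_gt0 // mulr_gt0.
have ts : t * (`|u| + `|v|) < s.
  have : t * m = s / 2 by rewrite /t; field; rewrite gt_eqF.
  rewrite /m mulrDr mulr1 => E.
  rewrite -[ltLHS](addrK t) E; apply: (@le_lt_trans _ _ (s / 2)); lra.
have [sr sr1 sr2] : [/\ s <= r, s <= r1 & s <= r2].
  by rewrite /s !ge_min !lexx /= ?orbT.
have [|y1 y1b E1] := quad t v u (ltW t0).
  by rewrite addrC; exact: lt_le_trans ts sr.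
have [|y2 y2b E2] := quad t u v (ltW t0).
  exact: lt_le_trans ts sr.
have tri (a b c d : R) : `|a - c| <= d / 2 -> `|b - c| <= d / 2 -> `|a - b| <= 0 + d.
  move=> ac bc; rewrite add0r (splitr d) (le_trans (ler_distD c a b)) // lerD //.
  by rewrite distrC.
have swap (a b c d : R) : a - b - (c - d) = a - c - (b - d) by ring.
(* The two second differences differ only by exchanging their middle terms. Cancelling [t] twice,
   the mixed derivatives agree at two points near [p], and their continuity at [p] concludes. *)
have E : 'D_u ('D_v f) y1 = 'D_v ('D_u f) y2.
  apply: (mulfI (lt0r_neq0 t0)); apply: (mulfI (lt0r_neq0 t0)).
  apply: eq_trans (esym E1) (eq_trans _ E2).
  rewrite [p + t *: v + _]addrAC; exact: swap.
have /H1 K1 : ball p r1 y1.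
  rewrite -ball_normE /=; apply: le_lt_trans y1b _.
  by rewrite addrC; exact: lt_le_trans ts sr1.
have /H2 K2 : ball p r2 y2.
  rewrite -ball_normE /=; apply: le_lt_trans y2b _.
  exact: lt_le_trans ts sr2.
by rewrite -E in K2; exact: tri K1 K2.
Qed.

End Rows.

(** * The maximum norm of matrices *)

Section MatrixNorm.
Variable R : realType.

Lemma ler_mx_coord m n (M : 'M[R]_(m, n)) i j : `|M i j| <= `|M|.
Proof. by rewrite [leRHS]/Num.Def.normr /= mx_normrE (le_bigmax _ _ (i, j)). Qed.

Lemma mx_norm_le m n (M : 'M[R]_(m, n)) (c : R) :
  0 <= c -> (forall i j, `|M i j| <= c) -> `|M| <= c.
Proof.
by move=> c0 Mc; rewrite [leLHS]/Num.Def.normr /= mx_normrE bigmax_le // => -[i j] _.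
Qed.

(** The norm is the largest absolute value of an entry, and each entry of the product is a sum of
    [n] terms; hence the factor [n]. *)
Lemma mx_norm_mul m n k (M : 'M[R]_(m, n)) (N : 'M[R]_(n, k)) :
  `|M *m N| <= n%:R * (`|M| * `|N|).
Proof.
apply: mx_norm_le => [|i j]; first by rewrite mulr_ge0 ?ler0n // mulr_ge0.
rewrite mxE (le_trans (ler_norm_sum _ _ _)) //.
rewrite mulr_natl -[X in _ *+ X]card_ord -sumr_const; apply: ler_sum => l _.
by rewrite normrM ler_pM // ler_mx_coord.
Qed.

End MatrixNorm.

(** * Uniform local bounds up to second order *)

Section LocalBounds.
Variables (R : realType) (n : nat).
Notation V := 'rV[R]_n.

Lemma near_norm_le (W : normedModType R) (g : V -> W) (p : V) :
  {for p, continuous g} -> \forall x \near p, `|g x| <= `|g p| + 1.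
Proof.
move=> /cvgrPdist_le/(_ _ ltr01); apply: filterS => x gx.
by rewrite -[g x](subKr (g p)) (le_trans (ler_normB _ _)) // lerD2l.
Qed.

(** Expanding [w] in coordinates leaves finitely many partial derivatives, each bounded near [p] by
    continuity; hence one constant for all [w]. *)
Lemma near_bounds (O : set V) (f : V -> R) (p : V) : open O -> O p -> Ck 2 O f ->
  exists C : R, \forall x \near p, [/\ `|f x| <= C,
    forall w, `|'D_w f x| <= C * `|w| &
    forall w, `|'D_w ('D_w f) x| <= C * `|w| ^+ 2].
Proof.
move=> oO Op C2.
pose D i := 'D_(delta_mx 0 i : V) f.
pose H j i := 'D_(delta_mx 0 j : V) (D i).
have D0 x : O x -> differentiable f x by exact: Ck_differentiable C2.
have D1 w x : O x -> differentiable ('D_w f) x by exact: Ck_differentiable (Ck_derive w C2).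
have D2 i j x : O x -> differentiable (H j i) x.
  exact: Ck_differentiable (Ck_derive (delta_mx 0 j) (Ck_derive (delta_mx 0 i) C2)).
pose SD := \sum_i (`|D i p| + 1).
pose SH := \sum_i \sum_j (`|H j i p| + 1).
have SD0 : 0 <= SD by apply: sumr_ge0 => i _; rewrite addr_ge0.
have SH0 : 0 <= SH by apply: sumr_ge0 => i _; apply: sumr_ge0 => j _; rewrite addr_ge0.
exists (`|f p| + 1 + SD + SH); near=> x.
have Ox : O x by near: x; exact: open_nbhs_nbhs.
have fx : `|f x| <= `|f p| + 1.
  by near: x; apply: near_norm_le; exact/differentiable_continuous/D0.
have Dx i : `|D i x| <= `|D i p| + 1.
  move: i; near: x; apply: filter_forall => i; apply: near_norm_le.
  exact/differentiable_continuous/D1.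
have Hx i j : `|H j i x| <= `|H j i p| + 1.
  move: i j; near: x; apply: filter_forall => i; apply: filter_forall => j.
  by apply: near_norm_le; exact/differentiable_continuous/D2.
split=> [|w|w].
- by rewrite (le_trans fx) // -addrA lerDl addr_ge0.
- rewrite derive_coord; last exact/D0.
  apply: (@le_trans _ _ (SD * `|w|)); last first.
    by rewrite ler_wpM2r // -addrA addrCA lerDl addr_ge0 // addr_ge0.
  rewrite (le_trans (ler_norm_sum _ _ _)) // mulr_suml ler_sum // => i _.
 by rewrite normrZ mulrC ler_pM //; [exact: Dx|exact: ler_mx_coord].
(* The second derivative along [w] is the Hessian form evaluated at [w]. *)
have -> : 'D_w ('D_w f) x = \sum_i \sum_j w 0 i * (w 0 j * H j i x).
  have -> : 'D_w ('D_w f) x = 'D_w (fun y => \sum_i w 0 i *: D i y) x.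
    apply: near_eq_derive; near=> y; rewrite derive_coord //; apply/D0.
    by near: y; exact: open_nbhs_nbhs.
  have dw i : is_derive x w (w 0 i \*: D i) (w 0 i *: 'D_w (D i) x).
    by apply: is_deriveZ; apply: DeriveDef => //; apply: diff_derivable; exact/D1.
  have -> : (fun y => \sum_i w 0 i *: D i y) = \sum_(i < n) (w 0 i \*: D i).
    by apply/funext => y; rewrite fct_sumE.
  rewrite derive_val; apply: eq_bigr => i _.
  rewrite derive_coord; last exact/D1.
  by rewrite scaler_sumr.
apply: (@le_trans _ _ (SH * `|w| ^+ 2)); last first.
  by rewrite ler_wpM2r ?sqr_ge0 // lerDr !addr_ge0.
rewrite (le_trans (ler_norm_sum _ _ _)) // mulr_suml ler_sum // => i _.
rewrite (le_trans (ler_norm_sum _ _ _)) // mulr_suml ler_sum // => j _.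
rewrite mulrA normrM mulrC ler_pM //.
by rewrite normrM expr2 ler_pM //; exact: ler_mx_coord.
Unshelve. all: by end_near. Qed.

(** These are the estimates on which the Euler scheme rests. They are proved entry by entry, with
    the sum of the entrywise constants (plus 1, for positivity) as common bound. *)
Lemma local_bounds a b (O : set V) (A : V -> 'M[R]_(a, b)) (p : V) :
  open O -> O p -> Ck 2 O A ->
  exists r C : R, [/\ 0 < r, 0 < C, ball p r `<=` O &
    [/\ forall x, ball p r x -> `|A x| <= C,
        forall x w, ball p r x -> `|'D_w A x| <= C * `|w|,
        forall x w, ball p r x -> ball p r (x + w) -> `|A (x + w) - A x| <= C * `|w| &
        forall x w, ball p r x -> ball p r (x + w) ->
          `|A (x + w) - A x - 'D_w A x| <= C * `|w| ^+ 2]].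
Proof.
move=> oO Op C2.
have C2' i j := (Ck_mx 2 A oO).1 C2 i j.
have /choice[C HC] : forall ij : 'I_a * 'I_b, exists c : R, \forall x \near p,
    [/\ `|A x ij.1 ij.2| <= c,
    forall w, `|'D_w (fun y => A y ij.1 ij.2) x| <= c * `|w| &
    forall w, `|'D_w ('D_w (fun y => A y ij.1 ij.2)) x| <= c * `|w| ^+ 2].
  by move=> -[i j]; exact: near_bounds oO Op (C2' i j).
pose K := \sum_ij `|C ij| + 1.
have CK ij : C ij <= K.
  rewrite /K (bigD1 ij) //= -addrA (le_trans (ler_norm _)) // lerDl addr_ge0 //.
  exact: sumr_ge0.
have K0 : 0 < K by rewrite ltr_wpDl //; exact: sumr_ge0.
have : \forall x \near p, O x /\ forall ij,
    [/\ `|A x ij.1 ij.2| <= C ij,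
    forall w, `|'D_w (fun y => A y ij.1 ij.2) x| <= C ij * `|w| &
    forall w, `|'D_w ('D_w (fun y => A y ij.1 ij.2)) x| <= C ij * `|w| ^+ 2].
  near=> x; split; first by near: x; exact: open_nbhs_nbhs.
  by near: x; exact: filter_forall.
move=> /nbhs_ballP[r /= r0 Hr]; exists r, K.
have dA x : ball p r x -> differentiable A x.
  by move=> /Hr[Ox _]; exact: Ck_differentiable C2 Ox.
have dA1 x i j : ball p r x -> differentiable (fun y => A y i j) x.
  by move=> /Hr[Ox _]; exact: Ck_differentiable (C2' i j) Ox.
have dA2 x w i j : ball p r x -> differentiable ('D_w (fun y => A y i j)) x.
  by move=> /Hr[Ox _]; exact: Ck_differentiable (Ck_derive w (C2' i j)) Ox.
have DE x w i j : ball p r x -> 'D_w A x i j = 'D_w (fun y => A y i j) x.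
  by move=> bx; rewrite derive_mx ?mxE //; apply: diff_derivable; exact: dA.
split=> //; first by move=> x /Hr[].
split.
- move=> x /Hr[_ H]; apply: mx_norm_le => [|i j]; first exact: ltW.
  by case: (H (i, j)) => + _ _ => /le_trans; apply.
- move=> x w bx; apply: mx_norm_le => [|i j]; first by rewrite mulr_ge0 // ltW.
  have [_ H] := Hr _ bx; case: (H (i, j)) => _ /(_ w) + _; rewrite DE // => /le_trans; apply.
  by rewrite ler_wpM2r.
- move=> x w bx bxw; apply: mx_norm_le => [|i j]; first by rewrite mulr_ge0 // ltW.
  have [|c c01] := @MVT_line _ _ (fun y => A y i j) x w.
    by move=> t t01; apply: dA1; exact: ball_segment.
  rewrite 2!mxE => ->.
  have [_ H] := Hr _ (ball_segment c01 bx bxw); case: (H (i, j)) => _ /(_ w) + _ => /le_trans; apply.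
  by rewrite ler_wpM2r.
- move=> x w bx bxw; apply: mx_norm_le => [|i j]; first by rewrite mulr_ge0 ?sqr_ge0 // ltW.
  (* The Taylor remainder is ['D_w] at [x + c *: w] minus ['D_w] at [x]; a second use of the mean
     value theorem makes it [c] times a second derivative, with [c <= 1]. *)
  have [|c c01 E] := @MVT_line _ _ (fun y => A y i j) x w.
    by move=> t t01; apply: dA1; exact: ball_segment.
  have bc := ball_segment c01 bx bxw.
  have [|d d01 E'] := @MVT_line _ _ ('D_w (fun y => A y i j)) x (c *: w).
    by move=> t t01; apply: dA2; exact: ball_segment.
  have bd := ball_segment d01 bx bc.
  rewrite 4!mxE E DE // E' derive_scaler; last exact: dA2.
  have [c0 c1] := andP c01.
  rewrite normrM (ger0_norm c0) (le_trans (ler_piMl _ c1)) //.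
  have [_ H] := Hr _ bd; case: (H (i, j)) => _ _ /(_ w) /le_trans; apply.
  by rewrite ler_wpM2r // sqr_ge0.
Unshelve. all: by end_near. Qed.

End LocalBounds.

(** * Total differential equations by Euler polygons *)

(** If a set of a finer filter had its preimage outside [F], its complement would lie in the image
    filter, and the two would meet in the empty set. *)
Lemma fmap_ultra (T U : Type) (f : T -> U) (F : set_system T) :
  UltraFilter F -> UltraFilter (f @ F).
Proof.
move=> FU; split; first exact: fmap_proper_filter.
move=> G GF FG; apply/seteqP; split=> A; last exact: FG.
move=> GA; have [//|nA] := in_ultra_setVsetC (f @^-1` A) FU.
exfalso; apply: (@filter_not_empty _ G _).
by rewrite -(setICr A); apply: filterI => //; exact: FG.
Qed.

(** Induction step of a discrete Gronwall estimate: [e] is the error at time [t], [d] the step and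
    [g] the local defect. As [t <= 1], half the error is at most [D], so a step adds at most [d * D]
    by propagation and [d * D] by defect. *)
Lemma gronwall_step (R : realFieldType) (e g u d t D : R) :
  u <= e + d * (1 / 2 * e) -> e <= 2 * D * t -> g <= d * D ->
  0 <= d -> 0 <= D -> t <= 1 -> u + g <= 2 * D * (t + d).
Proof.
move=> ue et gD d0 D0 t1.
have e2D : e <= 2 * D by apply: le_trans et _; rewrite ler_piMr // mulr_ge0.
have : d * (1 / 2 * e) <= d * D by apply: ler_wpM2l => //; lra.
by rewrite mulrDr; lra.
Qed.

Section Euler.
Variables (R : realType) (m n : nat) (A : 'rV[R]_n -> 'M[R]_(m, n)).
Variables (p : 'rV[R]_n) (r M : R).
Hypothesis M0 : 0 < M.
Let B := ball p r.
Hypothesis A_bound : forall (h : 'rV[R]_m) x, B x -> `|h *m A x| <= M * `|h|.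
Hypothesis dA_bound : forall (h : 'rV[R]_m) x w, B x ->
  `|h *m 'D_w A x| <= M * `|h| * `|w|.
Hypothesis A_lip : forall (h : 'rV[R]_m) x w, B x -> B (x + w) ->
  `|h *m (A (x + w) - A x)| <= M * `|h| * `|w|.
Hypothesis A_taylor : forall (h : 'rV[R]_m) x w, B x -> B (x + w) ->
  `|h *m (A (x + w) - A x - 'D_w A x)| <= M * `|h| * `|w| ^+ 2.
Hypothesis A_diff : forall x, B x -> differentiable A x.
Hypothesis A_comm : forall x (h k : 'rV[R]_m), B x ->
  k *m 'D_(h *m A x) A x = h *m 'D_(k *m A x) A x.

(** The step [d] is independent of the number [j] of steps, so that inductions on [j] keep it fixed;
    the polygon is used up to time [d * j%:R <= 1]. *)
Fixpoint euler (d : R) (h : 'rV[R]_m) (j : nat) : 'rV[R]_n :=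
  if j is j'.+1 then
    let z := euler d h j' in z + d *: (h *m A z)
  else p.

Variable s : R.
(** For [|h|] and [|h + k|] at most [s], a polygon moves by at most [M * s] and the correction in
    [k] by at most [2 * M * s]: the first bound keeps everything in [B]. The second makes the field
    [h *m A] Lipschitz with constant 1/2. *)
Hypotheses (s0 : 0 < s) (sr : 3 * M * s < r) (sM : M * s <= 1 / 2).

Let BE x : `|x - p| < r -> B x.
Proof. by rewrite /B -ball_normE /= distrC. Qed.

(** Each step has length at most [d * (M * |h|)]; up to time 1 the polygon therefore remains in [B],
    where [A_bound] permits the next step. *)
Lemma euler_dist d h j : 0 <= d -> d * j%:R <= 1 -> `|h| <= s ->
  `|euler d h j - p| <= d * j%:R * (M * `|h|).
Proof.
move=> d0; elim: j => [|j IH] dj hs; first by rewrite subrr normr0 mulr0 mul0r.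
have dj' : d * j%:R <= 1.
  by apply: le_trans dj; rewrite ler_wpM2l // ler_nat.
have Mh : M * `|h| <= M * s by rewrite ler_pM2l.
have Mh0 : 0 <= M * `|h| by rewrite mulr_ge0 // ltW.
have Bz : B (euler d h j).
  apply: BE; apply: le_lt_trans (IH dj' hs) _.
  have : d * j%:R * (M * `|h|) <= M * `|h| by rewrite ler_piMl.
  by have := ltW s0; have := ltW M0; move: sr Mh; nra.
rewrite /= addrAC (le_trans (ler_normD _ _)) // -natr1 mulrDr mulr1 mulrDl.
by rewrite lerD ?IH // normrZ ger0_norm // ler_wpM2l // A_bound.
Qed.

(** One step has defect at most [d * (d * C1 + C2 * |k|^2)]: [C1] collects the terms due to the step
    of the polygon, [C2] those quadratic in [k]. *)
Let C1 := 2 * M ^+ 2 * s ^+ 2 + 2 * M ^+ 3 * s ^+ 3.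
Let C2 := M ^+ 3 * s + M ^+ 2.

Let C1_ge0 : 0 <= C1.
Proof.
have M' := ltW M0; have s' := ltW s0.
by rewrite /C1 addr_ge0 // mulr_ge0 ?exprn_ge0 // mulr_ge0 ?exprn_ge0.
Qed.

Let C2_ge0 : 0 <= C2.
Proof.
have M' := ltW M0; have s' := ltW s0.
by rewrite /C2 addr_ge0 ?mulr_ge0 ?exprn_ge0.
Qed.

(* [z + (d j) k A z] is a first-order guess for the Euler polygon of [h + k];
   by [A_comm] it satisfies the recursion of that polygon up to [O(d^2 + d |k|^2)]. *)
Lemma euler_perturb d h k j : 0 <= d -> d <= 1 -> d * j%:R <= 1 ->
  `|h| <= s -> `|h + k| <= s ->
  let z := euler d h j in
  `|z + (d * j%:R) *: (k *m A z) - euler d (h + k) j|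
    <= 2 * (d * C1 + C2 * `|k| ^+ 2) * (d * j%:R).
Proof.
move=> d0 d1; set D := d * C1 + _.
elim: j => [|j IH] dj hs hks /=.
  by rewrite mulr0 scale0r addr0 subrr normr0 mulr0.
have dj' : d * j%:R <= 1.
  by apply: le_trans dj; rewrite ler_wpM2l // ler_nat.
have dj0 : 0 <= d * j%:R by rewrite mulr_ge0.
have djS : d * j.+1%:R = d * j%:R + d by rewrite -natr1 mulrDr mulr1.
move: IH => /(_ dj' hs hks); rewrite djS /=.
have zd := euler_dist d0 dj' hs.
have yd := euler_dist d0 dj' hks.
have z'd := euler_dist d0 dj hs.
rewrite /= djS in z'd; rewrite djS in dj.
move: zd yd z'd dj dj' dj0; set t := d * j%:R.
set z := euler d h j; set y := euler d (h + k) j.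
set w := d *: (h *m A z); set z' := z + w.
set v := t *: (k *m A z); set c := z + v.
move=> zd yd z'd dj dj' dj0 IH.
have k2s : `|k| <= 2 * s.
  by rewrite -[k](addKr h) (le_trans (ler_normD _ _)) // normrN; lra.
have Mhs : M * `|h| <= M * s by rewrite ler_pM2l.
have Mhks : M * `|h + k| <= M * s by rewrite ler_pM2l.
have Mk : M * `|k| <= M * (2 * s) by rewrite ler_pM2l.
have Ms0 : 0 < M * s by exact: mulr_gt0.
have nh := normr_ge0 h; have nk := normr_ge0 k; have nhk := normr_ge0 (h + k).
have zp : `|z - p| <= M * s.
  apply: le_trans zd _; apply: le_trans (ler_piMl _ dj') Mhs.
  by rewrite mulr_ge0 // ltW.
have Msr : 3 * (M * s) < r by rewrite mulrA.
have Ms_r : M * s < r by lra.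
have Bz : B z by apply: BE; exact: le_lt_trans zp Ms_r.
have By : B y.
  apply: BE; apply: le_lt_trans yd _.
  by rewrite (le_lt_trans (ler_piMl _ dj')) ?mulr_ge0 ?(ltW M0) // (le_lt_trans Mhks).
have Bz' : B z'.
  apply: BE; apply: le_lt_trans z'd _.
  by rewrite (le_lt_trans (ler_piMl _ dj)) ?mulr_ge0 ?(ltW M0) // (le_lt_trans Mhs).
have nv : `|v| <= M * `|k|.
  rewrite normrZ ger0_norm // (le_trans (ler_piMl _ dj')) //; exact: A_bound.
have nw : `|w| <= d * (M * s).
  by rewrite normrZ ger0_norm // ler_wpM2l // (le_trans (A_bound _ Bz)).
have Bc : B c.
  apply: BE; rewrite /c addrAC (le_lt_trans (ler_normD _ _)) //; lra.
(* [E] is the defect of the guess [c] over one step. After expanding [A] at [z] to first order, the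
   terms [(t * d) *: (k *m 'D_(h *m A z) A z)] cancel by [A_comm]; Taylor remainders and terms of
   order [d^2] or [d |k|^2] are left. *)
pose E := d *: (k *m (A z' - A z)) + t *: (k *m (A z' - A z - 'D_w A z))
   - d *: ((h + k) *m (A c - A z - 'D_v A z)) - (t * d) *: (k *m 'D_(k *m A z) A z).
have -> : z' + (t + d) *: (k *m A z') - (y + d *: ((h + k) *m A y)) =
    (c - y) + d *: ((h + k) *m (A c - A y)) + E.
  have ident (z0 y0 hz kz kz' hkc hky P Q : 'rV[R]_n) :
      z0 + d *: hz + (t + d) *: kz' - (y0 + d *: hky) =
      z0 + t *: kz - y0 + d *: (hkc - hky) + (d *: (kz' - kz)
        + t *: (kz' - kz - d *: P) - d *: (hkc - (hz + kz) - (t *: P + t *: Q))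
        - (t * d) *: Q).
    by apply/rowP => i; rewrite !mxE; ring.
  have Ew : k *m 'D_w A z = d *: (k *m 'D_(h *m A z) A z).
    by rewrite derive_scaler ?scalemxAr //; exact: A_diff.
  have Ev : (h + k) *m 'D_v A z =
      t *: (k *m 'D_(h *m A z) A z) + t *: (k *m 'D_(k *m A z) A z).
    rewrite derive_scaler; last exact: A_diff.
    by rewrite -scalemxAr mulmxDl -A_comm // scalerDr.
  rewrite /E (mulmxBr k (A z' - A z)) (mulmxBr k (A z')) (mulmxBr (h + k) (A c - A z)).
  rewrite (mulmxBr (h + k) (A c) (A z)) (mulmxBr (h + k) (A c) (A y)).
  rewrite (mulmxDl h k (A z)) Ew Ev.
  exact: ident.
have nE : `|E| <= d * D.
  have b1 : `|k *m (A z' - A z)| <= M * `|k| * (d * (M * s)).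
    by apply: le_trans (A_lip _ Bz Bz') _; rewrite ler_wpM2l // mulr_ge0 // ltW.
  have b2 : `|k *m (A z' - A z - 'D_w A z)| <= M * `|k| * (d * (M * s)) ^+ 2.
    apply: le_trans (A_taylor _ Bz Bz') _.
    by rewrite ler_wpM2l ?ler_pXn2r ?nnegrE // mulr_ge0 // ltW.
  have b3 : `|(h + k) *m (A c - A z - 'D_v A z)| <= M * s * (M * `|k|) ^+ 2.
    apply: le_trans (A_taylor _ Bz Bc) _.
    apply: ler_pM => //; first by rewrite mulr_ge0 // ltW.
    by rewrite ler_pXn2r ?nnegrE // mulr_ge0 // ltW.
  have b4 : `|k *m 'D_(k *m A z) A z| <= M * `|k| * (M * `|k|).
    by apply: le_trans (dA_bound _ _ Bz) _; rewrite ler_wpM2l ?A_bound // mulr_ge0 // ltW.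
  rewrite /E (le_trans (ler_normB _ _)) //.
  apply: (@le_trans _ _ (d * (M * `|k| * (d * (M * s))) + M * `|k| * (d * (M * s)) ^+ 2
      + d * (M * s * (M * `|k|) ^+ 2) + d * (M * `|k| * (M * `|k|)))).
    apply: lerD; last first.
      rewrite normrZ ger0_norm ?mulr_ge0 // ler_pM ?mulr_ge0 //.
      by rewrite ler_piMl.
    rewrite (le_trans (ler_normB _ _)) // lerD //; last first.
      by rewrite normrZ ger0_norm // ler_wpM2l.
    rewrite (le_trans (ler_normD _ _)) // lerD //.
      by rewrite normrZ ger0_norm // ler_wpM2l.
    by rewrite normrZ ger0_norm // (le_trans (ler_piMl _ dj')).
  have e1 : d * (M * `|k| * (d * (M * s))) <= d * (d * (2 * M ^+ 2 * s ^+ 2)).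
    have -> : d * (M * `|k| * (d * (M * s))) = d * (d * ((M * `|k|) * (M * s))) by ring.
    have -> : 2 * M ^+ 2 * s ^+ 2 = (M * (2 * s)) * (M * s) by ring.
    by do 2 (apply: ler_wpM2l => //); apply: ler_wpM2r => //; exact: ltW.
  have e2 : M * `|k| * (d * (M * s)) ^+ 2 <= d * (d * (2 * M ^+ 3 * s ^+ 3)).
    have -> : M * `|k| * (d * (M * s)) ^+ 2 = d * (d * ((M * `|k|) * (M * s) ^+ 2)) by ring.
    have -> : 2 * M ^+ 3 * s ^+ 3 = (M * (2 * s)) * (M * s) ^+ 2 by ring.
    by do 2 (apply: ler_wpM2l => //); apply: ler_wpM2r => //; exact: sqr_ge0.
  have e3 : d * (M * s * (M * `|k|) ^+ 2) + d * (M * `|k| * (M * `|k|)) = d * (C2 * `|k| ^+ 2).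
    by rewrite /C2; ring.
  have -> : d * D = d * (d * (2 * M ^+ 2 * s ^+ 2)) + d * (d * (2 * M ^+ 3 * s ^+ 3))
      + d * (C2 * `|k| ^+ 2) by rewrite /D /C1; ring.
  by rewrite -addrA e3; apply: lerD => //; exact: lerD.
rewrite (le_trans (ler_normD _ _)) //.
(* The old error is propagated by the field of [h + k], whose Lipschitz constant is at most 1/2. *)
have : `|c - y + d *: ((h + k) *m (A c - A y))| <= `|c - y| + d * (1 / 2 * `|c - y|).
  rewrite (le_trans (ler_normD _ _)) // lerD2l normrZ ger0_norm // ler_wpM2l //.
  have Byc : B (y + (c - y)) by rewrite addrC subrK.
  have := A_lip (h + k) By Byc; rewrite [y + _]addrC subrK => /le_trans; apply.
  by rewrite ler_wpM2r // (le_trans Mhks).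
have D0 : 0 <= D.
  by rewrite /D addr_ge0 // mulr_ge0 // exprn_ge0.
move=> S; apply: le_trans (lerD S nE) _.
exact: (gronwall_step (lexx _) IH (lexx _)).
Qed.

(** With [N + 1] steps of length [1 / (N + 1)] the polygon ends at time 1, in a closed ball that is
    compact. In the limit the [C1] part of the error disappears with the step length. *)
Lemma euler_limit : exists phi : 'rV[R]_m -> 'rV[R]_n,
  (forall h, `|h| <= s -> `|phi h - p| <= M * `|h|) /\
  (forall h k, `|h| <= s -> `|h + k| <= s ->
     `|phi h + k *m A (phi h) - phi (h + k)| <= 2 * C2 * `|k| ^+ 2).
Proof.
pose E N h := euler (N.+1%:R)^-1 h N.+1.
have dN N : 0 <= (N.+1%:R : R)^-1 <= 1.
  by rewrite invr_ge0 ler0n invf_le1 ?ltr0n // ler1n.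
have dNN N : (N.+1%:R : R)^-1 * N.+1%:R = 1 by rewrite mulVf // pnatr_eq0.
have Ed N h : `|h| <= s -> `|E N h - p| <= M * `|h|.
  move=> hs; have [d0 d1] := andP (dN N).
  have := @euler_dist (N.+1%:R)^-1 h N.+1 d0; rewrite dNN mul1r; exact.
have Ec N h k : `|h| <= s -> `|h + k| <= s ->
    `|E N h + k *m A (E N h) - E N (h + k)| <= 2 * ((N.+1%:R)^-1 * C1 + C2 * `|k| ^+ 2).
  move=> hs hks; have [d0 d1] := andP (dN N).
  by have := @euler_perturb (N.+1%:R)^-1 h k N.+1 d0 d1; move=> /(_ _ hs hks); rewrite dNN mulr1; cbv zeta; rewrite scale1r; exact.
(* The ultrafilter is fixed before [h], so all endpoints converge along it and a single [N] serves
   for [h] and [h + k] together. *)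
have [G [GU ooG]] := @ultraFilterLemma nat \oo _.
(* Outside [|h| <= s] the limit map takes the default value [p]. *)
have /choice[phi Hphi] : forall h, exists l, `|h| <= s ->
    `|l - p| <= M * `|h| /\ (E^~ h @ G --> l).
  move=> h; have [hs|] := boolP (`|h| <= s); last by exists p.
  pose K := [set x : 'rV[R]_n | `|x - p| <= M * `|h|].
  have cK : compact K.
    apply: bounded_closed_compact.
      exists (`|p| + M * `|h|); split; first exact: num_real.
      move=> x px y /= Ky; rewrite (le_trans _ (ltW px)) //.
      by rewrite -[y](subrK p) (le_trans (ler_normD _ _)) // addrC lerD2l.
    have -> : K = closed_ball_ Num.norm p (M * `|h|).
      by apply/seteqP; split=> x; rewrite /K /closed_ball_ /= distrC.
    exact: closed_closed_ball_.
  have GK : (E^~ h @ G) K by apply: ooG; near=> N; exact: Ed.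
  move: cK; rewrite compact_ultra => /(_ (E^~ h @ G) (fmap_ultra _ GU) GK)[l [Kl El]].
  by exists l.
exists phi; split=> [h /Hphi[]//|h k hs hks].
have [hd hcv] := Hphi _ hs; have [hkd hkcv] := Hphi _ hks.
have Bh x : `|x - p| <= M * `|h| -> B x.
  move=> xp; apply: BE; apply: le_lt_trans xp _; apply: le_lt_trans sr.
  have : M * `|h| <= M * s by rewrite ler_pM2l.
  have := mulr_gt0 M0 s0; lra.
apply/ler_addgt0Pr => e e0.
(* [q] adds up the coefficients of the tolerance: 2 from the two limits, [M * |k|] from the
   Lipschitz bound, [2 * C1] from the step length. *)
pose q := 2 + M * `|k| + 2 * C1.
have q0 : 0 < q by rewrite /q -addrA ltr_pwDl // addr_ge0 ?mulr_ge0 // ltW.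
have eq0 : 0 < e / q by rewrite divr_gt0.
have G1 : G (fun N => `|phi h - E N h| <= e / q).
  by have /cvgrPdist_le/(_ _ eq0) := hcv.
have G2 : G (fun N => `|phi (h + k) - E N (h + k)| <= e / q).
  by have /cvgrPdist_le/(_ _ eq0) := hkcv.
have G3 : G (fun N => (N.+1%:R)^-1 <= e / q).
  by apply: ooG; near=> N; apply: ltW; near: N; exact: near_infty_natSinv_lt (PosNum eq0).
have [N [[N1 N2] N3]] := filter_ex (filterI (filterI G1 G2) G3).
have lip : `|k *m (A (phi h) - A (E N h))| <= M * `|k| * (e / q).
  have BE' := Bh _ (Ed N h hs); have Bphi := Bh _ hd.
  have := A_lip k BE' (_ : B (E N h + (phi h - E N h))).
  rewrite [_ + (_ - _)]addrC subrK => /(_ Bphi)/le_trans; apply.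
  by rewrite ler_wpM2l // mulr_ge0 // ltW.
have -> : phi h + k *m A (phi h) - phi (h + k) =
    (phi h - E N h) + k *m (A (phi h) - A (E N h))
    + (E N h + k *m A (E N h) - E N (h + k)) - (phi (h + k) - E N (h + k)).
  by rewrite mulmxBr; apply/rowP => i; rewrite !mxE; ring.
rewrite (le_trans (ler_normB _ _)) //.
apply: (@le_trans _ _ ((e / q + M * `|k| * (e / q) + 2 * (e / q * C1 + C2 * `|k| ^+ 2)) + e / q)).
  apply: lerD => //; rewrite (le_trans (ler_normD _ _)) // lerD //.
    by rewrite (le_trans (ler_normD _ _)) // lerD.
  apply: le_trans (Ec N h k hs hks) _.
  by rewrite ler_pM2l // lerD2r ler_wpM2r.
have -> : e / q + M * `|k| * (e / q) + 2 * (e / q * C1 + C2 * `|k| ^+ 2) + e / q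
   = 2 * C2 * `|k| ^+ 2 + q * (e / q) by rewrite /q; ring.
by rewrite lerD2l mulrC divfK // gt_eqF.
Unshelve. all: by end_near. Qed.

(** The remainder in [euler_limit] is quadratic in [k], so it is small compared with [|k|]; the
    strict bound [|h| < s] leaves room for [h + k]. *)
Lemma euler_flow : exists phi : 'rV[R]_m -> 'rV[R]_n, phi 0 = p /\
  forall h, `|h| < s -> B (phi h) /\ is_diff h phi (fun k => k *m A (phi h)).
Proof.
have [phi [phi_dist phi_diff]] := euler_limit; exists phi; split.
  apply/eqP; rewrite -subr_eq0 -normr_le0.
  by have := phi_dist 0; rewrite normr0 mulr0; apply; exact: ltW.
move=> h hs.
have Bh : B (phi h).
  apply: BE; apply: le_lt_trans (phi_dist _ (ltW hs)) _; apply: le_lt_trans sr.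
  have : M * `|h| <= M * s by rewrite ler_pM2l // ltW.
  have := mulr_gt0 M0 s0; lra.
split=> //.
have cA : continuous (mulmxr (A (phi h)) : 'rV[R]_m -> 'rV[R]_n).
  apply: bounded_linear_continuous.
  exists (M * 1); split; first exact: num_real.
  move=> x px; apply/nbhs_ballP; exists 1 => //= k.
  rewrite -ball_normE /= sub0r normrN => /ltW k1.
  apply: le_trans (A_bound _ Bh) _.
  by apply: le_trans (ltW px); rewrite ler_pM2l.
have C20 : 0 <= 2 * C2 by exact: mulr_ge0.
apply: (@is_diff_of_remainder _ _ _ _ (mulmxr (A (phi h)))) => // e e0.
near=> k.
have hks : `|h + k| <= s.
  rewrite (le_trans (ler_normD _ _)) // -lerBrDl.
  near: k; apply/nbhs_ballP; exists (s - `|h|) => /=; first by rewrite subr_gt0.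
  by move=> k; rewrite -ball_normE /= sub0r normrN => /ltW.
have := phi_diff _ _ (ltW hs) hks.
rewrite distrC [in X in X -> _]opprD addrA [h + k]addrC /= => /le_trans; apply.
rewrite expr2 mulrA ler_wpM2r //.
apply: (@le_trans _ _ ((2 * C2 + 1) * `|k|)).
  by rewrite ler_wpM2r // lerDl ler01.
rewrite mulrC -ler_pdivlMr; last by rewrite ltr_wpDl.
near: k; apply/nbhs_ballP; exists (e / (2 * C2 + 1)) => /=.
  by apply: divr_gt0 => //; apply: ltr_wpDl.
by move=> k; rewrite -ball_normE /= sub0r normrN => /ltW.
Unshelve. all: by end_near. Qed.

End Euler.

Lemma total_differential_solution (R : realType) (m n : nat)
    (A : 'rV[R]_n -> 'M[R]_(m, n)) (O : set 'rV[R]_n) (p : 'rV[R]_n) :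
  open O -> O p -> Ck 2 O A ->
  (forall x (h k : 'rV[R]_m), O x ->
     k *m 'D_(h *m A x) A x = h *m 'D_(k *m A x) A x) ->
  exists (s : R) (phi : 'rV[R]_m -> 'rV[R]_n), [/\ 0 < s, phi 0 = p &
    forall h, `|h| < s -> O (phi h) /\ is_diff h phi (fun k => k *m A (phi h))].
Proof.
move=> oO Op C2 comm.
have [r [C [r0 C0 rO [b1 b2 b3 b4]]]] := local_bounds oO Op C2.
(* The factor [m] comes from the norm of a product with a row of length [m]; adding 1 makes [M]
   positive. *)
pose M := m%:R * C + 1.
have mC0 : 0 <= m%:R * C by rewrite mulr_ge0 // ltW.
have M0 : 0 < M by rewrite ltr_wpDl.
have bnd (h : 'rV[R]_m) (N : 'M[R]_(m, n)) c : `|N| <= C * c -> `|h *m N| <= M * `|h| * c.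
  move=> Nc; have c0 : 0 <= c by rewrite -(pmulr_rge0 _ C0) (le_trans (normr_ge0 N)).
  apply: le_trans (mx_norm_mul _ _) _.
  apply: (@le_trans _ _ (m%:R * (`|h| * (C * c)))).
    by rewrite ler_wpM2l // ler_wpM2l.
  have -> : m%:R * (`|h| * (C * c)) = m%:R * C * (`|h| * c) by ring.
  by rewrite -[leRHS]mulrA ler_wpM2r ?mulr_ge0 // /M lerDl.
(* The first term gives [3 * M * s < r], the second [M * s <= 1 / 2]. *)
pose s := Num.min (r / (4 * M)) (1 / (2 * M)).
have s0 : 0 < s by rewrite lt_min !divr_gt0 // mulr_gt0.
have sr : 3 * M * s < r.
  have : s <= r / (4 * M) by rewrite /s ge_min lexx.
  rewrite ler_pdivlMr ?mulr_gt0 //; have := mulr_gt0 M0 s0.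
  have -> : s * (4 * M) = 4 * (M * s) by ring.
  by rewrite -mulrA; lra.
have sM : M * s <= 1 / 2.
  have : s <= 1 / (2 * M) by rewrite /s ge_min lexx orbT.
  rewrite ler_pdivlMr ?mulr_gt0 //.
  have -> : s * (2 * M) = 2 * (M * s) by ring.
  by lra.
have [||||||phi [phi0 Hphi]] := @euler_flow R m n A p r M M0 _ _ _ _ _ _ s s0 sr sM.
- by move=> h x bx; rewrite -[leRHS]mulr1; apply: bnd; rewrite mulr1; exact: b1.
- by move=> h x w bx; apply: bnd; exact: b2.
- by move=> h x w bx bxw; apply: bnd; exact: b3.
- by move=> h x w bx bxw; apply: bnd; exact: b4.
- by move=> x bx; exact: Ck_differentiable C2 (rO _ bx).
- by move=> x h k bx; apply: comm; exact: rO.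
exists s, phi; split=> // h /Hphi[bh dh]; split=> //; exact: rO.
Qed.

(** * The Frobenius theorem *)

Section MatrixCalculus.
Variables (R : realType) (V : normedModType R).

Lemma Ck_mulmx k a b c (U : set V) (M : V -> 'M[R]_(a, b)) (N : V -> 'M[R]_(b, c)) :
  open U -> Ck k U M -> Ck k U N -> Ck k U (fun x => M x *m N x).
Proof.
move=> oU CM CN; apply/Ck_mx => // i j; under eq_fun do rewrite mxE.
by apply: Ck_sum => // l _; apply: CkM => //; [apply/Ck_mx: i l|apply/Ck_mx: l j].
Qed.

Lemma Ck_mull k (U : set V) (a : R) (f : V -> R) :
  open U -> Ck k U f -> Ck k U (fun x => a * f x).
Proof. by move=> oU Cf; apply: CkM => //; exact: Ck_cst. Qed.

Lemma Ck_det k c (U : set V) (M : V -> 'M[R]_c) :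
  open U -> Ck k U M -> Ck k U (fun x => \det (M x)).
Proof.
move=> oU CM; apply: Ck_sum => // s _.
apply: Ck_mull => //.
by apply: Ck_prod => // i _; exact: (Ck_mx k M oU).1.
Qed.

(** The adjugate is polynomial in the entries; divided by the determinant it gives an inverse whose
    regularity is visible. *)
Lemma Ck_adj k c (U : set V) (M : V -> 'M[R]_c) :
  open U -> Ck k U M -> Ck k U (fun x => \adj (M x)).
Proof.
move=> oU CM; apply/Ck_mx => // i j; under eq_fun do rewrite mxE.
apply: Ck_mull => //.
apply: Ck_det => //; apply/Ck_mx => // i' j'; under eq_fun do rewrite !mxE.
exact: (Ck_mx k M oU).1.
Qed.

Lemma derive_mulmx a b c (M : V -> 'M[R]_(a, b)) (N : V -> 'M[R]_(b, c)) (x v : V) :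
  differentiable M x -> differentiable N x ->
  'D_v (fun y => M y *m N y) x = 'D_v M x *m N x + M x *m 'D_v N x.
Proof.
move=> dM dN.
have dMij i j : derivable (fun y => M y i j) x v.
  by apply/diff_derivable; exact: (differentiable_mx M x).1.
have dNij i j : derivable (fun y => N y i j) x v.
  by apply/diff_derivable; exact: (differentiable_mx N x).1.
have dMN i j l : is_derive x v ((fun y => M y i l) * (fun y => N y l j))
    (M x i l *: 'D_v (fun y => N y l j) x + N x l j *: 'D_v (fun y => M y i l) x).
  by apply: is_deriveM; exact: DeriveDef.
have E i j : (fun y => (M y *m N y) i j) =
    \sum_(l < b) ((fun y => M y i l) * (fun y => N y l j)).
  by apply/funext => y; rewrite mxE fct_sumE.
rewrite derive_mx; last first.
  by apply/derivable_mxP => i j; rewrite E; apply: derivable_sum => l; have [] := dMN i j l.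
apply/matrixP => i j; rewrite !mxE E derive_val -big_split /=.
apply: eq_bigr => l _; rewrite !derive_mx ?mxE; [|exact: diff_derivable..].
by rewrite addrC [N x l j *: _]mulrC.
Qed.

End MatrixCalculus.

(* The bracket of two rows of [A] lies in the row space of [B] and in the kernel
   of [Th x], which meet trivially. *)
Lemma commuting_frame (R : realType) (n m c : nat) (O : set 'rV[R]_n)
    (A : 'rV[R]_n -> 'M[R]_(m, n)) (Th : 'rV[R]_n -> 'M[R]_(n, c)) (x : 'rV[R]_n)
    (dF : 'rV[R]_n -> 'M[R]_(m, c)) (B : 'M[R]_(c, n)) (Gi : 'M[R]_c) (h k : 'rV[R]_m) :
  open O -> O x -> differentiable A x -> differentiable Th x ->
  (forall y, O y -> A y *m Th y = 0) ->
  (forall u, 'D_u A x = dF u *m B) -> B *m Th x *m Gi = 1%:M ->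
  (forall u v : 'rV[R]_n, u *m Th x = 0 -> v *m Th x = 0 ->
     v *m 'D_u Th x = u *m 'D_v Th x) ->
  k *m 'D_(h *m A x) A x = h *m 'D_(k *m A x) A x.
Proof.
move=> oO Ox dA dT AT DA BG inv; apply/eqP; rewrite -subr_eq0; apply/eqP.
(* Differentiating [A *m Th = 0], valid near [x], moves derivatives from [A] to [Th], where [inv]
   applies. *)
have DAT w : 'D_w A x *m Th x = - (A x *m 'D_w Th x).
  apply/eqP; rewrite -addr_eq0 -derive_mulmx //; apply/eqP.
  rewrite -[RHS](derive_cst (0 : 'M[R]_(m, c)) x w); apply: near_eq_derive.
  by apply: filterS (open_nbhs_nbhs (conj oO Ox)) => y Oy; rewrite AT.
have hT (l : 'rV[R]_m) : l *m A x *m Th x = 0 by rewrite -mulmxA AT // mulmx0.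
have := inv _ _ (hT h) (hT k).
have := DAT (k *m A x); have := DAT (h *m A x); rewrite !DA.
move: (dF (h *m A x)) (dF (k *m A x)) => F1 F2.
move: ('D_(h *m A x) Th x) ('D_(k *m A x) Th x) => T1 T2 E1 E2 I.
rewrite !mulmxA -mulmxBl; set d := k *m F1 - h *m F2.
suff -> : d = 0 by rewrite mul0mx.
rewrite -[d]mulmx1 -BG !mulmxA.
suff -> : d *m B *m Th x = 0 by rewrite mul0mx.
rewrite /d !mulmxBl -(mulmxA k) -(mulmxA h) -(mulmxA k) -(mulmxA h) E1 E2.
by rewrite !mulmxN !mulmxA opprK I addNr.
Qed.

Section Frobenius.
Variables (R : realType) (n m c : nat) (U : set 'rV[R]_n).
Variables (Th : 'rV[R]_n -> 'M[R]_(n, c)) (p : 'rV[R]_n).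
Variables (E : 'M[R]_(m, n)) (B : 'M[R]_(c, n)).
Hypotheses (oU : open U) (Up : U p) (Th_smooth : forall k, Ck k U Th).
(** The columns of [Th] are 1-forms; the equality says that their exterior derivatives vanish on
    pairs of vectors of the common kernel. *)
Hypothesis involutive : forall x (u v : 'rV[R]_n), U x ->
  u *m Th x = 0 -> v *m Th x = 0 -> v *m 'D_u Th x = u *m 'D_v Th x.
Hypotheses (ETh : E *m Th p = 0) (BTh : B *m Th p = 1%:M).
Hypothesis E_inj : forall h : 'rV[R]_m, h *m E = 0 -> h = 0.
Hypothesis EB_full : forall v : 'rV[R]_n, exists d h, v = d *m B + h *m E.

(** On [O], the row space of [B] is a complement of the kernel of [Th x], and [A x] projects the
    rows of [E] to that kernel along it. Only a component in the row space of [B] varies with [x],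
    so brackets of rows of [A] lie there. *)
Let G x := B *m Th x.
Let O := U `&` [set x | \det (G x) != 0].
Let F x := E *m Th x *m ((\det (G x))^-1 *: \adj (G x)).
Let A x := E - F x *m B.

Let G_smooth k : Ck k U G.
Proof. by apply: (@Ck_mulmx R _ k _ _ _ U (fun=> B)) => //; exact: Ck_cst. Qed.

Let open_O : open O.
Proof.
rewrite openE => x [Ux dx]; rewrite /interior.
have cd : {for x, continuous (fun y => \det (G y))}.
  apply: differentiable_continuous.
  exact: Ck_differentiable (Ck_det oU (G_smooth 0)) Ux.
near=> y; split; first by near: y; exact: open_nbhs_nbhs.
have : \det (G y) != 0 by near: y; exact: cvgr_neq0 cd dx.
by [].
Unshelve. all: by end_near. Qed.

Let OU x : O x -> U x. Proof. by case. Qed.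

Let Op : O p.
Proof. by split=> //=; rewrite /G BTh det1 oner_neq0. Qed.

Let GK x : O x -> ((\det (G x))^-1 *: \adj (G x)) *m G x = 1%:M.
Proof.
by move=> [_ dx]; rewrite -scalemxAl mul_adj_mx scale_scalar_mx mulVf.
Qed.

Let GKr x : O x -> G x *m ((\det (G x))^-1 *: \adj (G x)) = 1%:M.
Proof.
by move=> [_ dx]; rewrite -scalemxAr mul_mx_adj scale_scalar_mx mulVf.
Qed.

Let F_smooth k : Ck k O F.
Proof.
have CG : Ck k O G by apply: Ck_sub (G_smooth k).
have CT : Ck k O Th by exact: Ck_sub (Th_smooth k).
have CE : Ck k O (fun=> E) by exact: Ck_cst.
have CGi : Ck k O (fun x => (\det (G x))^-1 *: \adj (G x)).
  apply/Ck_mx => // i j; under eq_fun do rewrite mxE.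
  apply: CkM => //; last exact: (Ck_mx k _ open_O).1 (Ck_adj open_O CG) i j.
  apply: CkV => //; last exact: Ck_det.
  by move=> x [].
exact: Ck_mulmx (Ck_mulmx open_O CE CT) CGi.
Qed.

Let AE x : A x = (fun y => E + (- F y) *m B) x.
Proof. by rewrite /A mulNmx. Qed.

Let NF_smooth k : Ck k O (fun y => - F y).
Proof.
apply/Ck_mx => // i j; under eq_fun do rewrite mxE -mulN1r.
apply: Ck_mull => //.
exact: (Ck_mx k F open_O).1.
Qed.

Let A_smooth k : Ck k O A.
Proof.
have CE : Ck k O (fun=> E) by exact: Ck_cst.
have CB : Ck k O (fun=> B) by exact: Ck_cst.
apply: Ck_ext open_O _ (CkD open_O CE (Ck_mulmx open_O (NF_smooth k) CB)) => x _.
by rewrite AE.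
Qed.

Let A_ker x : O x -> A x *m Th x = 0.
Proof.
by move=> Ox; rewrite mulmxBl -mulmxA -/(G x) /F -[_ *m G x]mulmxA GK // mulmx1 subrr.
Qed.

Let derive_A x u : O x -> 'D_u A x = - 'D_u F x *m B.
Proof.
move=> Ox.
have dF : differentiable F x by exact: Ck_differentiable (F_smooth 0) Ox.
have dFB : differentiable (fun y => F y *m B) x.
  by apply: Ck_differentiable Ox; apply: (@Ck_mulmx R _ 0 _ _ _ O F (fun=> B)) => //; exact: Ck_cst.
have -> : A = cst E - (fun y => F y *m B) by [].
rewrite deriveB; [|exact: derivable_cst|exact: diff_derivable].
rewrite derive_cst sub0r (@derive_mulmx _ _ _ _ _ F (cst B)) //.
by rewrite derive_cst mulmx0 addr0 mulNmx.
Qed.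

Let A_comm x (h k : 'rV[R]_m) : O x ->
  k *m 'D_(h *m A x) A x = h *m 'D_(k *m A x) A x.
Proof.
move=> Ox.
have dA : differentiable A x by exact: Ck_differentiable (A_smooth 0) Ox.
have dT : differentiable Th x by exact: Ck_differentiable (Th_smooth 0) (OU Ox).
apply: (@commuting_frame _ _ _ _ O A Th x (fun u => - 'D_u F x) B _ h k
  open_O Ox dA dT A_ker _ (GKr Ox)); first by move=> u; exact: derive_A.
by move=> u v; exact: involutive (OU Ox).
Qed.

(** If [h *m A x = 0], then [h *m E] lies in the row space of [B]; applying [Th p], which kills [E]
    and is the identity on [B], shows that it vanishes. *)
Let A_inj x (h : 'rV[R]_m) : O x -> h *m A x = 0 -> h = 0.
Proof.
move=> Ox hA; have hE : h *m E = h *m F x *m B.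
  by apply/eqP; rewrite -subr_eq0 -(mulmxA h) -mulmxBr -/(A x) hA.
have : h *m E *m Th p = h *m F x by rewrite hE -(mulmxA _ B) BTh mulmx1.
by rewrite -(mulmxA h) ETh mulmx0 => /esym F0; apply: E_inj; rewrite hE F0 mul0mx.
Qed.

(** Writing [v = d *m B + h *m E], the vector [h *m A x] differs from [v] by an element of the row
    space of [B]; that element is killed by [Th x], hence zero. *)
Let A_full x (v : 'rV[R]_n) : O x -> v *m Th x = 0 -> exists h, h *m A x = v.
Proof.
move=> Ox vT; have [d [h vE]] := EB_full v; exists h.
have hA : h *m A x = v - (d + h *m F x) *m B.
  rewrite /A mulmxBr (mulmxA h) vE; move: (h *m F x) => f.
  by rewrite mulmxDl opprD addrA [d *m B + _]addrC addrK.
suff d0 : d + h *m F x = 0 by rewrite hA d0 mul0mx subr0.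
have : (d + h *m F x) *m G x = 0.
  have : h *m A x *m Th x = 0 by rewrite -(mulmxA h) A_ker // mulmx0.
  rewrite hA mulmxBl vT sub0r -(mulmxA _ B) => /eqP.
  by rewrite oppr_eq0 => /eqP.
move: (d + _) => f fG.
by rewrite -[f]mulmx1 -(GKr Ox) mulmxA fG mul0mx.
Qed.

Theorem frobenius : exists (N : set 'rV[R]_m) (phi : 'rV[R]_m -> 'rV[R]_n),
  [/\ open N, N 0, smooth_on N phi, phi 0 = p &
    forall s, N s -> [/\ U (phi s), forall h, 'd phi s h = 0 -> h = 0 &
      forall v, v *m Th (phi s) = 0 <-> exists h, 'd phi s h = v]].
Proof.
have [r [phi [r0 phi0 Hphi]]] :=
  total_differential_solution open_O Op (A_smooth 2) A_comm.
have bE (h : 'rV[R]_m) : ball 0 r h -> `|h| < r by rewrite -ball_normE /= sub0r normrN.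
exists (ball 0 r), phi.
have oN : open (ball (0 : 'rV[R]_m) r) by exact: ball_open.
have dE s : ball 0 r s -> forall h, 'd phi s h = h *m A (phi s).
  by move=> /bE/Hphi[_ [_ dphi]] h; rewrite dphi.
(* Bootstrap: the derivative of [phi] along [v] is [v *m A (phi s)], which is as regular as
   [phi]. *)
have phi_smooth k : Ck k (ball 0 r) phi.
  elim: k => [|k IH]; first by split=> // s /bE/Hphi[_ []].
  split=> [s /bE/Hphi[_ []]//|v].
  apply: (@Ck_ext R _ _ k _ (fun s => v *m A (phi s))) => //.
    by move=> s bs; rewrite deriveE ?dE //; have /bE/Hphi[_ []] := bs.
  apply: (@Ck_mulmx R _ k _ _ _ _ (fun=> v)) => //; first exact: Ck_cst.
  apply/Ck_mx => // i j.
  apply: (@Ck_comp R n _ k _ O phi (fun y => A y i j)) => //.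
    by move=> s /bE/Hphi[].
  exact: (Ck_mx k A open_O).1.
split=> //; [exact: ballxx|exact/smooth_onP|].
move=> s bs; have /bE/Hphi[Os _] := bs; split.
- exact: OU.
- by move=> h; rewrite dE //; exact: A_inj.
- move=> v; split=> [|[h <-]].
    by move=> /(A_full Os)[h <-]; exists h; exact: dE.
  rewrite dE //.
  by rewrite -(mulmxA h) A_ker // mulmx0.
Qed.

End Frobenius.

(** * Tangency to an integral surface forces involutivity *)

Section IntegrableInvolutive.
Variables (R : realType) (n m c : nat) (U : set 'rV[R]_n).
Variable Th : 'rV[R]_n -> 'M[R]_(n, c).
Hypotheses (oU : open U) (Th_diff : forall x, U x -> differentiable Th x).

(* Differentiate [(d phi k) Th(phi) = 0] along [h] and antisymmetrize: the second
   derivatives of [phi] cancel. *)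
Lemma integral_map_involutive (N : set 'rV[R]_m) (phi : 'rV[R]_m -> 'rV[R]_n)
    (s h k : 'rV[R]_m) : open N -> N s -> smooth_on N phi ->
  (forall t, N t -> U (phi t) /\ forall l, 'd phi t l *m Th (phi t) = 0) ->
  'd phi s k *m 'D_('d phi s h) Th (phi s) = 'd phi s h *m 'D_('d phi s k) Th (phi s).
Proof.
move=> oN Ns /smooth_onP sm H.
have dphi t : N t -> differentiable phi t by exact: Ck_differentiable (sm 0).
have dphi2 l t : N t -> differentiable ('D_l phi) t.
  exact: Ck_differentiable (Ck_derive l (sm 1)).
have Us := (H _ Ns).1.
have dTp : differentiable (Th \o phi) s.
  by apply: differentiable_comp; [exact: dphi|exact: Th_diff].
have DTp l : 'D_l (Th \o phi) s = 'D_('d phi s l) Th (phi s).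
  rewrite !deriveE //; last exact: Th_diff.
  by rewrite diff_comp //; [exact: dphi|exact: Th_diff].
have D2 l l' : 'D_l ('D_l' phi) s *m Th (phi s) + 'd phi s l' *m 'D_('d phi s l) Th (phi s) = 0.
  rewrite -DTp -[in X in _ + X *m _]deriveE; last exact: dphi.
  rewrite -(@derive_mulmx _ _ _ _ _ ('D_l' phi) (Th \o phi)) //; last exact: dphi2.
  rewrite -[RHS](derive_cst (0 : 'M[R]_(1, c)) s l); apply: near_eq_derive.
  apply: filterS (open_nbhs_nbhs (conj oN Ns)) => t Nt.
  by rewrite /= deriveE ?(H _ Nt).2 //; exact: dphi.
have sym : 'D_h ('D_k phi) s = 'D_k ('D_h phi) s.
  have E l l' i j : 'D_l ('D_l' phi) s i j = 'D_l ('D_l' (fun t => phi t i j)) s.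
    rewrite derive_mx; last by apply: diff_derivable; exact: dphi2.
    rewrite mxE; apply: near_eq_derive.
    apply: filterS (open_nbhs_nbhs (conj oN Ns)) => t Nt.
    by rewrite derive_mx ?mxE //; apply: diff_derivable; exact: dphi.
  apply/matrixP => i j.
  have S : Ck 2 N (fun t => phi t i j) by exact: (Ck_mx 2 phi oN).1.
  have Shk := Schwarz h k oN Ns S.
  apply: eq_trans (E h k i j) _.
  apply: eq_trans Shk _.
  exact: esym (E k h i j).
have Dkh := D2 k h; rewrite -sym in Dkh.
exact: addrI (etrans (D2 h k) (esym Dkh)).
Qed.

End IntegrableInvolutive.

(** * The transversal distribution of a web *)

Lemma sum2 (V : nmodType) (F : 'I_2 -> V) : \sum_(i < 2) F i = F 0 + F 1.
Proof.
by rewrite !big_ord_recl big_ord0 addr0; congr (_ + F _); exact: val_inj.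
Qed.

Lemma ord2P (P : 'I_2 -> Prop) : P 0 -> P 1 -> forall i, P i.
Proof.
move=> P0 P1 [[|[|//]] lti]; [have -> : Ordinal lti = 0|have -> : Ordinal lti = 1] => //;
exact: val_inj.
Qed.

(* The connection and torsion terms of [d (a_i omega^i)] cancel, whatever the
   sign [e] of the torsion. *)
Lemma dtheta_identity (R : comPzRingType) (e : R) (a x x' y y' z z' da da' dz : 'I_2 -> R)
    (c c' p q : 'I_2 -> 'I_2 -> R) :
  (forall i, da i - \sum_(j < 2) a j * c i j =
    \sum_(j < 2) p i j * x j + \sum_(j < 2) q i j * y j) ->
  (forall i, da' i - \sum_(j < 2) a j * c' i j =
    \sum_(j < 2) p i j * x' j + \sum_(j < 2) q i j * y' j) ->
  (forall i, dz i = \sum_(j < 2) (z j * c' j i - z' j * c j i)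
    + e * \sum_(j < 2) a j * (z j * z' i - z' j * z i)) ->
  \sum_(i < 2) (da i * z' i - da' i * z i + a i * dz i) =
  \sum_(i < 2) \sum_(j < 2) (p i j * (x j * z' i - x' j * z i)
                             + q i j * (y j * z' i - y' j * z i)).
Proof.
move=> Hu Hv Hz.
have Eu i : da i = \sum_(j < 2) a j * c i j + (\sum_(j < 2) p i j * x j + \sum_(j < 2) q i j * y j).
  by rewrite -Hu addrC subrK.
have Ev i : da' i = \sum_(j < 2) a j * c' i j + (\sum_(j < 2) p i j * x' j + \sum_(j < 2) q i j * y' j).
  by rewrite -Hv addrC subrK.
by rewrite !sum2 !Eu !Ev !Hz !sum2; ring.
Qed.

(** A nonzero covector of the plane has a kernel of dimension one, spanned by [(- a 1, a 0)]; [t] is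
    read off by dividing by a nonzero coordinate of [a]. *)
Lemma orthogonal2 (R : fieldType) (a x : 'I_2 -> R) :
  (exists i, a i <> 0) -> a 0 * x 0 + a 1 * x 1 = 0 ->
  exists t, x 0 = - a 1 * t /\ x 1 = a 0 * t.
Proof.
move=> [i ai] ax.
have [a0|a0] := eqVneq (a 0) 0.
  have a1 : a 1 != 0 by apply/eqP => a1; apply: ai; move: i; apply: ord2P.
  exists (- x 0 / a 1); split; first by field.
  by move: ax; rewrite a0 !mul0r add0r => /eqP; rewrite mulf_eq0 (negbTE a1) => /eqP.
exists (x 1 / a 0); split; last by field.
apply: (mulfI a0); move/eqP: ax; rewrite addr_eq0 => /eqP ->; field.
exact: a0.
Qed.

Section WebDistribution.
Variables (R : realType) (U : set 'rV[R]_4) (T : 'I_3 -> tangent_distribution R).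
Variables (om : 'I_3 -> 'I_2 -> form1 R) (conn : 'I_2 -> 'I_2 -> form1 R).
Variables (a : 'I_2 -> 'rV[R]_4 -> R) (b : 'I_2 -> 'I_2 -> 'I_2 -> 'I_2 -> 'rV[R]_4 -> R).
Variables (p q : 'I_2 -> 'I_2 -> 'rV[R]_4 -> R).
Hypotheses (oU : open U) (Hom : adapted_coframe U T om).
Hypotheses (Hstr : structure_equations U om conn a b).
Hypothesis Hpq : pfaffian_derivatives U om conn a p q.
Hypothesis a_neq0 : forall x, U x -> exists i, a i x <> 0.

(** This is [t] contracted twice with the vector [(- a 1, a 0)] that spans the kernel of [a]. *)
Let quad (t : 'I_2 -> 'I_2 -> 'rV[R]_4 -> R) x :=
  a 1 x ^+ 2 * t 0 0 x - 2 * a 0 x * a 1 x * symm t 0 1 x + a 0 x ^+ 2 * t 1 1 x.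

Definition leaf_index (i : 'I_2) : 'I_3 := if i == 0 then 0 else 1.

(** Column [i] holds the coefficients of the form [a_j omega^j] of the foliation [leaf_index i],
    which presents the distribution as a matrix kernel. *)
Definition theta (x : 'rV[R]_4) : 'M[R]_(4, 2) :=
  \matrix_(l, i) (\sum_(j < 2) a j x * om (leaf_index i) j x l 0).

Lemma evE (al : form1 R) x v : ev al x v = \sum_l v 0 l * al x l 0.
Proof. by rewrite /ev mxE. Qed.

Lemma evD (al : form1 R) x u v : ev al x (u + v) = ev al x u + ev al x v.
Proof. by rewrite /ev mulmxDl mxE. Qed.

Lemma evZ (al : form1 R) x t v : ev al x (t *: v) = t * ev al x v.
Proof. by rewrite /ev -scalemxAl mxE. Qed.

Lemma evB (al : form1 R) x u v : ev al x (u - v) = ev al x u - ev al x v.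
Proof. by rewrite -scaleN1r evD evZ mulN1r. Qed.

Lemma mul_theta x v i :
  (v *m theta x) 0 i = \sum_(j < 2) a j x * ev (om (leaf_index i) j) x v.
Proof.
rewrite mxE; under eq_bigr do rewrite mxE mulr_sumr; rewrite exchange_big /=.
by apply: eq_bigr => j _; rewrite evE mulr_sumr; apply: eq_bigr => l _; rewrite mulrCA.
Qed.

Lemma theta_ker x v : a_distribution om a x v <-> v *m theta x = 0.
Proof.
split=> [[H0 H1]|H].
  by apply/rowP; apply: ord2P; rewrite mul_theta sum2 mxE.
have K i : (v *m theta x) 0 i = 0 by rewrite H mxE.
by split; [have := K 0|have := K 1]; rewrite mul_theta sum2.
Qed.

Lemma theta_smooth k : Ck k U theta.
Proof.
apply/Ck_mx => // l i; under eq_fun do rewrite mxE.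
apply: Ck_sum => // j _; apply: CkM => //.
  by have /smooth_onP := a_smooth Hstr j; exact.
apply: (Ck_mx k _ oU).1.
by have /smooth_onP := om_smooth Hom (leaf_index i) j; exact.
Qed.

(** The coframe condition makes the coefficient matrix injective on rows; being square, as [2 + 2]
    computes to 4, it is invertible. *)
Lemma coframe_surj x (f0 f1 : 'I_2 -> R) : U x ->
  exists v, forall i, ev (om 0 i) x v = f0 i /\ ev (om 1 i) x v = f1 i.
Proof.
move=> Ux.
pose W (u : 'I_3) : 'M[R]_(4, 2) := \matrix_(l, i) om u i x l 0.
pose WW : 'M[R]_(4, 2 + 2) := row_mx (W 0) (W 1).
have WE u v i : (v *m W u) 0 i = ev (om u i) x v.
  by rewrite evE mxE; apply: eq_bigr => l _; rewrite mxE.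
have Wfree : row_free WW.
  apply: inj_row_free => v; rewrite mul_mx_row => vW.
  have [v0 v1] : v *m W 0 = 0 /\ v *m W 1 = 0 by apply: eq_row_mx; rewrite vW row_mx0.
  by apply: (om_coframe Hom Ux) => i; rewrite -WE ?v0 ?v1 mxE.
have Wunit : (WW : 'M[R]_4) \in unitmx by rewrite -row_free_unit.
exists (row_mx (\row_i f0 i) (\row_i f1 i) *m invmx (WW : 'M[R]_4)).
set v := _ *m _.
have : v *m WW = row_mx (\row_i f0 i) (\row_i f1 i) by rewrite /v mulmxKV.
rewrite mul_mx_row => /eq_row_mx[v0 v1] i.
by rewrite -!WE v0 v1 !mxE.
Qed.

Let eps x (i : 'I_2) : R := if i == 0 then - a 1 x else a 0 x.

Lemma a_distributionP x v : U x -> a_distribution om a x v ->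
  exists s t, forall i, ev (om 0 i) x v = eps x i * s /\ ev (om 1 i) x v = eps x i * t.
Proof.
move=> Ux [H0 H1].
have [s [s0 s1]] := @orthogonal2 R (a^~ x) (fun i => ev (om 0 i) x v) (a_neq0 Ux) H0.
have [t [t0 t1]] := @orthogonal2 R (a^~ x) (fun i => ev (om 1 i) x v) (a_neq0 Ux) H1.
by exists s, t; apply: ord2P.
Qed.

(** The left side is the exterior derivative of column [i] of [theta] on [(u, v)]. The product rule
    and the structure equations put it in the form treated by [dtheta_identity]. *)
Lemma dtheta x u v i : U x ->
  (v *m 'D_u theta x - u *m 'D_v theta x) 0 i =
  \sum_(k < 2) \sum_(j < 2)
   (p k j x * (ev (om 0 j) x u * ev (om (leaf_index i) k) x v
               - ev (om 0 j) x v * ev (om (leaf_index i) k) x u)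
  + q k j x * (ev (om 1 j) x u * ev (om (leaf_index i) k) x v
               - ev (om 1 j) x v * ev (om (leaf_index i) k) x u)).
Proof.
move=> Ux.
have dth : differentiable theta x by exact: Ck_differentiable (theta_smooth 0) Ux.
have da j : differentiable (a j) x.
  by have /smooth_onP/(_ 0)/Ck_differentiable := a_smooth Hstr j; exact.
have dom w j (z : 'rV[R]_4) : differentiable (fun y => ev (om w j) y z) x.
  have /smooth_onP/(_ 0) C := om_smooth Hom w j.
  have := @Ck_mulmx R _ 0 _ _ _ U (fun=> z) (om w j) oU (Ck_cst _ _ _) C.
  by move=> /(Ck_mx 0 _ oU) /(_ 0 0) /Ck_differentiable; exact.
have D w (z : 'rV[R]_4) : (z *m 'D_w theta x) 0 i = \sum_(j < 2)
    ('D_w (a j) x * ev (om (leaf_index i) j) x z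
     + a j x * 'D_w (fun y => ev (om (leaf_index i) j) y z) x).
  have dz : differentiable (fun y => z *m theta y) x.
    apply: Ck_differentiable Ux.
    by apply: (@Ck_mulmx R _ 0 _ _ _ U (fun=> z)) => //; exact: theta_smooth.
  have -> : z *m 'D_w theta x = 'D_w (fun y => z *m theta y) x.
    by rewrite (@derive_mulmx _ _ _ _ _ (cst z) theta) // derive_cst mul0mx add0r.
  rewrite derive_mx ?mxE; last exact: diff_derivable.
  under eq_fun do rewrite mul_theta.
  have dj j : is_derive x w (a j * (fun y => ev (om (leaf_index i) j) y z))
      (a j x *: 'D_w (fun y => ev (om (leaf_index i) j) y z) x
       + ev (om (leaf_index i) j) x z *: 'D_w (a j) x).
    by apply: is_deriveM; apply: DeriveDef => //; exact: diff_derivable.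
  have -> : (fun y => \sum_(j < 2) a j y * ev (om (leaf_index i) j) y z) =
      \sum_(j < 2) (a j * (fun y => ev (om (leaf_index i) j) y z)).
    by apply/funext => y; rewrite fct_sumE.
  rewrite derive_val; apply: eq_bigr => j _.
  by rewrite addrC; congr (_ + _); exact: mulrC.
have subE (M N : 'rV[R]_2) : (M - N) 0 i = M 0 i - N 0 i by rewrite !mxE.
apply: etrans (subE _ _) _.
apply: etrans (congr2 (fun y z => y - z) (D u v) (D v u)) _; rewrite -sumrB.
(* The torsion enters the two structure equations with opposite signs. *)
pose e : R := if i == 0 then 1 else - 1.
have := @dtheta_identity R e (a^~ x)
  (fun j => ev (om 0 j) x u) (fun j => ev (om 0 j) x v)
  (fun j => ev (om 1 j) x u) (fun j => ev (om 1 j) x v)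
  (fun j => ev (om (leaf_index i) j) x u) (fun j => ev (om (leaf_index i) j) x v)
  (fun j => 'D_u (a j) x) (fun j => 'D_v (a j) x)
  (fun j => dform (om (leaf_index i) j) x u v)
  (fun k j => ev (conn k j) x u) (fun k j => ev (conn k j) x v)
  (fun k j => p k j x) (fun k j => q k j x).
move=> <-; [|by move=> k; exact: Hpq|by move=> k; exact: Hpq|].
  apply: eq_bigr => j _; rewrite /dform.
  move: ('D_u (a j) x) ('D_v (a j) x) ('D_u _ x) ('D_v _ x) => d1 d2 d3 d4.
  by ring.
move=> j; rewrite /e; move: i {D e subE}; apply: ord2P; rewrite /leaf_index /=.
  by rewrite mul1r; exact: structure_om1 Hstr _ _ _ _ Ux.
by rewrite mulN1r; exact: structure_om2 Hstr _ _ _ _ Ux.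
Qed.

(* On vectors with coordinates [s eps, t eps], the two components of [d theta]
   are [quad q] and [quad p] times the determinant of the coordinates. *)
Lemma involutiveP x : U x ->
  (forall u v : 'rV[R]_4, u *m theta x = 0 -> v *m theta x = 0 ->
     v *m 'D_u theta x = u *m 'D_v theta x) <->
  quad p x = 0 /\ quad q x = 0.
Proof.
move=> Ux.
(* In component 0 the [p] terms carry [s * s' - s' * s = 0], so only [q] is left; in component 1 the
   roles are exchanged. *)
have key u v s t s' t' :
    (forall i, ev (om 0 i) x u = eps x i * s /\ ev (om 1 i) x u = eps x i * t) ->
    (forall i, ev (om 0 i) x v = eps x i * s' /\ ev (om 1 i) x v = eps x i * t') ->
    (v *m 'D_u theta x - u *m 'D_v theta x) 0 0 = quad q x * (t * s' - t' * s) /\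
    (v *m 'D_u theta x - u *m 'D_v theta x) 0 1 = quad p x * (s * t' - s' * t).
  move=> Hu Hv; rewrite !dtheta // !sum2 /leaf_index /=.
  rewrite !(Hu _).1 !(Hu _).2 !(Hv _).1 !(Hv _).2 /eps /quad /symm /=.
  by split; field.
split=> [I|[P Q] u v /theta_ker/(a_distributionP Ux)[s [t Hu]] /theta_ker/(a_distributionP Ux)[s' [t' Hv]]].
  (* These two vectors of the distribution have coordinate determinant 1, so both quadratic
     expressions can be read off up to sign. *)
  have [u Hu] := coframe_surj (eps x) (fun=> 0) Ux.
  have [v Hv] := coframe_surj (fun=> 0) (eps x) Ux.
  have Ku : u *m theta x = 0.
    by apply/theta_ker; split; rewrite ?(Hu _).1 ?(Hu _).2 /eps /=; ring.
  have Kv : v *m theta x = 0.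
    by apply/theta_ker; split; rewrite ?(Hv _).1 ?(Hv _).2 /eps /=; ring.
  have [i|i|] := key u v 1 0 0 1.
  - by rewrite (Hu i).1 (Hu i).2 mulr1 mulr0.
  - by rewrite (Hv i).1 (Hv i).2 mulr1 mulr0.
  rewrite I // subrr !mxE => Q P; split.
    by rewrite P; ring.
  by apply/eqP; rewrite -oppr_eq0 Q; apply/eqP; ring.
have [E0 E1] := key _ _ _ _ _ _ Hu Hv.
apply/eqP; rewrite -subr_eq0; apply/eqP/rowP; apply: ord2P.
  by apply: etrans E0 _; rewrite Q mul0r mxE.
by apply: etrans E1 _; rewrite P mul0r mxE.
Qed.

(** Pointwise data for [frobenius]: the rows of [E] span the distribution at [x], those of [B] a
    complement dual to the columns of [theta x]. *)
Lemma theta_split x : U x -> exists (E B : 'M[R]_(2, 4)),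
  [/\ E *m theta x = 0, B *m theta x = 1%:M,
      forall h : 'rV[R]_2, h *m E = 0 -> h = 0 &
      forall v : 'rV[R]_4, exists d h, v = d *m B + h *m E].
Proof.
move=> Ux.
(* A vector [c] with [a(c) = 1]; placed in either half of the coframe it gives the two rows of
   [B]. *)
have [c cP] : exists c : 'I_2 -> R, \sum_(j < 2) a j x * c j = 1.
  have [j /eqP aj] := a_neq0 Ux; exists (fun l => if l == j then (a j x)^-1 else 0).
  rewrite (bigD1 j) //= eqxx mulfV // big1 ?addr0 // => l /negbTE ->.
  by rewrite mulr0.
have [e0 He0] := coframe_surj (eps x) (fun=> 0) Ux.
have [e1 He1] := coframe_surj (fun=> 0) (eps x) Ux.
have [b0 Hb0] := coframe_surj c (fun=> 0) Ux.
have [b1 Hb1] := coframe_surj (fun=> 0) c Ux.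
pose rows (u v : 'rV[R]_4) : 'M[R]_(2, 4) := \matrix_i (if i == 0 then u else v).
have rowsE (h : 'rV[R]_2) u v : h *m rows u v = h 0 0 *: u + h 0 1 *: v.
  by rewrite mulmx_sum_row sum2 !rowK.
have ker (u : 'rV[R]_4) : (forall i, (u *m theta x) 0 i = 0) -> u *m theta x = 0.
  by move=> K; apply/rowP => i; rewrite K mxE.
have eps_a t : \sum_(j < 2) a j x * (eps x j * t) = 0.
  by rewrite sum2 /eps /=; ring.
have e0_ker : e0 *m theta x = 0.
  apply: ker; apply: ord2P; rewrite mul_theta /leaf_index /=; under eq_bigr do
    rewrite ?(He0 _).1 ?(He0 _).2.
    by rewrite -[RHS](eps_a 1); apply: eq_bigr => j _; rewrite mulr1.
  by rewrite big1 // => j _; rewrite mulr0.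
have e1_ker : e1 *m theta x = 0.
  apply: ker; apply: ord2P; rewrite mul_theta /leaf_index /=; under eq_bigr do
    rewrite ?(He1 _).1 ?(He1 _).2.
    by rewrite big1 // => j _; rewrite mulr0.
  by rewrite -[RHS](eps_a 1); apply: eq_bigr => j _; rewrite mulr1.
have b0E : b0 *m theta x = delta_mx 0 0.
  apply/rowP; apply: ord2P; rewrite mul_theta /leaf_index /= mxE; under eq_bigr do
    rewrite ?(Hb0 _).1 ?(Hb0 _).2.
    by rewrite cP.
  by rewrite big1 // => j _; rewrite mulr0.
have b1E : b1 *m theta x = delta_mx 0 1.
  apply/rowP; apply: ord2P; rewrite mul_theta /leaf_index /= mxE; under eq_bigr do
    rewrite ?(Hb1 _).1 ?(Hb1 _).2.
    by rewrite big1 // => j _; rewrite mulr0.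
  by rewrite cP.
have rows_theta (h : 'rV[R]_2) : h *m rows b0 b1 *m theta x = h.
  rewrite rowsE mulmxDl -!scalemxAl b0E b1E.
  by apply/rowP; apply: ord2P; rewrite !mxE /= ?mulr1 ?mulr0 ?addr0 ?add0r.
have rows_ker (h : 'rV[R]_2) : h *m rows e0 e1 *m theta x = 0.
  by rewrite rowsE mulmxDl -!scalemxAl e0_ker e1_ker !scaler0 addr0.
exists (rows e0 e1), (rows b0 b1); split.
- by apply/row_matrixP => i; rewrite row_mul rowE rows_ker row0.
- by apply/row_matrixP => i; rewrite row_mul rowE rows_theta row1.
- move=> h hE.
  have hi i : eps x i * h 0 0 = 0 /\ eps x i * h 0 1 = 0.
    have z u : ev (om u i) x (h *m rows e0 e1) = 0 by rewrite hE /ev mul0mx mxE.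
    have := z 1; have := z 0; rewrite rowsE !evD !evZ !(He0 i).1 !(He0 i).2 !(He1 i).1 !(He1 i).2.
    by rewrite !mulr0 addr0 add0r ![h _ _ * _]mulrC => -> ->.
  have [i ei] : exists i, eps x i != 0.
    have [j /eqP aj] := a_neq0 Ux; move: j aj; apply: ord2P => aj.
      by exists 1.
    by exists 0; rewrite /eps /= oppr_eq0.
  have [/eqP h0 /eqP h1] := hi i.
  apply/rowP; apply: ord2P; rewrite mxE; apply/eqP.
    by move: h0; rewrite mulf_eq0 (negbTE ei).
  by move: h1; rewrite mulf_eq0 (negbTE ei).
(* Subtracting [d *m B] removes the values of the forms on [v]; the rest lies in the distribution,
   and its parameters [s], [t] are the coordinates along [E]. *)
move=> v; pose d := v *m theta x.
have /theta_ker/(a_distributionP Ux)[s [t Hst]] : (v - d *m rows b0 b1) *m theta x = 0.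
  by rewrite mulmxBl rows_theta subrr.
exists d, (\row_i (if i == 0 then s else t)).
apply/eqP; rewrite addrC -subr_eq -subr_eq0; apply/eqP.
rewrite (rowsE _ e0 e1) !mxE /=.
apply: (om_coframe Hom Ux) => i; rewrite evB [ev _ _ (_ *: _ + _)]evD !evZ ?(He0 i).1 ?(He0 i).2 ?(He1 i).1 ?(He1 i).2.
  by rewrite (Hst i).1; ring.
by rewrite (Hst i).2; ring.
Qed.

End WebDistribution.

Theorem theorem1 (R : realType) (U : set 'rV[R]_4) (HU : open U)
  (T : 'I_3 -> tangent_distribution R) (HT : three_web U T)
  (om : 'I_3 -> 'I_2 -> form1 R) (Hom : adapted_coframe U T om)
  (conn : 'I_2 -> 'I_2 -> form1 R) (a : 'I_2 -> 'rV[R]_4 -> R)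
  (b : 'I_2 -> 'I_2 -> 'I_2 -> 'I_2 -> 'rV[R]_4 -> R)
  (Hstr : structure_equations U om conn a b)
  (p q : 'I_2 -> 'I_2 -> 'rV[R]_4 -> R)
  (Hpq : pfaffian_derivatives U om conn a p q)
  (Ha : forall x, U x -> exists i, a i x <> 0) :
  integrable_distribution U (a_distribution om a) <->
  (forall x, U x ->
     a 1 x ^+ 2 * p 0 0 x - 2 * a 0 x * a 1 x * symm p 0 1 x
       + a 0 x ^+ 2 * p 1 1 x = 0 /\
     a 1 x ^+ 2 * q 0 0 x - 2 * a 0 x * a 1 x * symm q 0 1 x
       + a 0 x ^+ 2 * q 1 1 x = 0).
Proof.
have smooth := theta_smooth HU Hom Hstr.
have diffTh x : U x -> differentiable (theta om a) x.
  exact: Ck_differentiable (smooth 0).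
split=> [Hint x Ux|Hpq0 x Ux].
  apply: (involutiveP HU Hom Hstr Hpq Ha Ux).1 => u v /theta_ker Du /theta_ker Dv.
  have [N [phi [oN N0 sm phi0 Hphi]]] := Hint x Ux.
  have Hk t : N t -> U (phi t) /\ forall l, 'd phi t l *m theta om a (phi t) = 0.
    move=> /Hphi[Ut _ im]; split=> // l.
    by apply/theta_ker/im; exists l.
  have [_ _ im] := Hphi _ N0; rewrite phi0 in im.
  (* Vectors of the distribution at [x] are images of parameter directions, so involutivity along
     the surface through [x] covers all of them. *)
  have [h <-] := (im u).1 Du; have [k <-] := (im v).1 Dv.
  by have := integral_map_involutive diffTh h k oN N0 sm Hk; rewrite phi0.
have inv y (u v : 'rV[R]_4) : U y -> u *m theta om a y = 0 -> v *m theta om a y = 0 ->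
    v *m 'D_u (theta om a) y = u *m 'D_v (theta om a) y.
  by move=> Uy; apply: (involutiveP HU Hom Hstr Hpq Ha Uy).2; exact: Hpq0.
have [E [B [ETh BTh Einj full]]] := theta_split Hom Ha Ux.
have [N [phi [oN N0 sm phi0 Hphi]]] := frobenius HU Ux smooth inv ETh BTh Einj full.
exists N, phi; split=> // s /Hphi[Us inj im]; split=> // v.
by apply: iff_trans (im v); exact: theta_ker.
Qed.
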